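(* Let $N,D\ge 1$ be integers, $T>0$, $q>2$, $\delta>1$, $\eta_-,\eta_+\ge0$, $M>0$, and let $p$ be the conjugate exponent of $q$ ($\frac1p+\frac1q=1$). Then there is a constant $\theta>p$, depending only on $q,\delta,M,\eta_-,\eta_+,N$, and, for every $\tau>0$, a constant $C(\tau)>0$, depending only on $q,\delta,M,\eta_-,\eta_+,N$ and $\tau$, such that the following holds. Let $H:\mathbb{R}^N\times(0,T)\times\mathbb{R}^N\to\mathbb{R}$ be a continuous function satisfying $$\frac1\delta|z|^q-\eta_-\le H(x,t,z)\le\delta|z|^q+\eta_+\qquad\forall(x,t,z)\in\mathbb{R}^N\times(0,T)\times\mathbb{R}^N,$$ let $a=\sigma\sigma^*$ where $\sigma:\mathbb{R}^N\times(0,T)\to\mathbb{R}^{N\times D}$ is locally Lipschitz continuous with $\|\sigma(x,t)\|\le\delta$ for all $(x,t)\in\mathbb{R}^N\times(0,T)$, and let $u\in C(\mathbb{R}^N\times[0,T])$ be a viscosity solution of $$u_t(x,t)-\mathrm{Tr}\left(a(x,t)D^2u(x,t)\right)+H(x,t,Du(x,t))=0\quad\text{in }\mathbb{R}^N\times(0,T)$$ such that $|u|\le M$ in $\mathbb{R}^N\times[0,T]$. Then, for every $\tau>0$, $$|u(x_1,t_1)-u(x_2,t_2)|\le C(\tau)\left[|x_1-x_2|^{\frac{\theta-p}{\theta-1}}+|t_1-t_2|^{\frac{\theta-p}{\theta}}\right]\qquad\forall(x_1,t_1),(x_2,t_2)\in\mathbb{R}^N\times[\tau,T].$$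
   Context: $\mathbb{R}^{N\times D}$ is the space of real $N\times D$ matrices with norm $\|\sigma\|=\sqrt{\mathrm{Tr}(\sigma\sigma^* )}$, where $\sigma^*$ is the transpose of $\sigma$. $u_t=\partial u/\partial t$; $Du$ and $D^2u$ are the gradient and Hessian in $x$. The matrix $a$ may be degenerate, and $H$ is not assumed convex in $z$. *)

(* Defs.v *)
From HB Require Import structures.
From mathcomp Require Import all_boot all_order all_algebra.
From mathcomp Require Import all_classical all_reals all_analysis.

Set Implicit Arguments.
Unset Strict Implicit.
Unset Printing Implicit Defensive.

Import Order.TTheory GRing.Theory Num.Theory.
Import numFieldNormedType.Exports.

Local Open Scope classical_set_scope.
Local Open Scope ring_scope.

(* Points (x, t) of space-time are elements of 'rV[R]_N * R.  Topological
   notions (continuity, neighbourhoods, local Lipschitz continuity) come from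
   the library's max norms on matrices and products; these are equivalent to the
   Euclidean ones, so the notions are the usual ones.  Wherever the value
   of a norm matters, [frobenius] is used instead. *)

(* sqrt (Tr (A A^T)); for a row vector x this is the Euclidean norm |x|. *)
Definition frobenius (R : realType) (m n : nat) (A : 'M[R]_(m, n)) : R :=
  Num.sqrt (\tr (A *m A^T)).

Definition open_strip (R : realType) (N : nat) (T : R) : set ('rV[R]_N * R) :=
  [set w | 0 < w.2 < T].

Definition closed_strip (R : realType) (N : nat) (s T : R) :
    set ('rV[R]_N * R) :=
  [set w | s <= w.2 <= T].

Definition locally_lipschitz (R : realType) (V W : normedModType R)
    (A : set V) (f : V -> W) : Prop :=
  forall x, A x -> exists2 U, nbhs x U & [lipschitz f y | y in U `&` A].

Section SpaceTimeDerivatives.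
Context {R : realType} {N : nat}.
Implicit Types (phi : 'rV[R]_N * R -> R) (w : 'rV[R]_N * R) (i j : 'I_N).

Definition dt phi w : R := derive1 (fun t => phi (w.1, t)) w.2.

Definition dx i phi w : R :=
  'D_(delta_mx 0 i) (fun x => phi (x, w.2)) w.1.

Definition gradx phi w : 'rV[R]_N := \row_i dx i phi w.

Definition hessx phi w : 'M[R]_N := \matrix_(i, j) dx j (dx i phi) w.

(* 'D_v and derive1 are total, so existence of the derivatives is required
   separately. *)
Definition derivable_t phi w : Prop :=
  derivable (fun t => phi (w.1, t)) w.2 1.

Definition derivable_x i phi w : Prop :=
  derivable (fun x => phi (x, w.2)) w.1 (delta_mx 0 i).

(* Test functions: C^2 in x and C^1 in t, with jointly continuous derivatives. *)
Definition C21 (A : set ('rV[R]_N * R)) phi : Prop :=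
  [/\ {within A, continuous phi},
      (forall w, A w -> derivable_t phi w) /\ {within A, continuous (dt phi)},
      forall i, (forall w, A w -> derivable_x i phi w) /\
        {within A, continuous (dx i phi)} &
      forall i j, (forall w, A w -> derivable_x j (dx i phi) w) /\
        {within A, continuous (dx j (dx i phi))}].

End SpaceTimeDerivatives.

Section ViscositySolutions.
Context {R : realType} {N : nat}.
Variables (T : R) (a : 'rV[R]_N * R -> 'M[R]_N).
Variables (H : 'rV[R]_N -> R -> 'rV[R]_N -> R).
Implicit Types (u phi : 'rV[R]_N * R -> R) (w : 'rV[R]_N * R).

Definition HJ_operator phi w : R :=
  dt phi w - \tr (a w *m hessx phi w) + H w.1 w.2 (gradx phi w).

Definition viscosity_subsolution u : Prop :=
  forall phi, C21 (open_strip T) phi ->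
  forall w, open_strip T w ->
  (\forall v \near w, u v - phi v <= u w - phi w) ->
  HJ_operator phi w <= 0.

Definition viscosity_supersolution u : Prop :=
  forall phi, C21 (open_strip T) phi ->
  forall w, open_strip T w ->
  (\forall v \near w, u w - phi w <= u v - phi v) ->
  0 <= HJ_operator phi w.

(* Continuity of u is not part of the definition; it is assumed
   separately, up to the boundary times. *)
Definition viscosity_solution u : Prop :=
  viscosity_subsolution u /\ viscosity_supersolution u.

End ViscositySolutions.

(* Main.v *)
Require Import Defs.
From HB Require Import structures.
From mathcomp Require Import all_boot all_order all_algebra.
From mathcomp Require Import all_classical all_reals all_analysis.
From mathcomp Require Import ring lra.

Set Implicit Arguments.
Unset Strict Implicit.
Unset Printing Implicit Defensive.

Import Order.TTheory GRing.Theory Num.Theory.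
Import numFieldNormedType.Exports.

Local Open Scope classical_set_scope.
Local Open Scope ring_scope.

(** The equation gives two one-sided differential inequalities,
    u_t - Tr(a D^2 u) + |Du|^q / delta <= etam and
    u_t - Tr(a D^2 u) + delta |Du|^q >= - etap, in the viscosity sense.
    Hoelder continuity follows from a decay of the oscillation on cylinders that
    shrink geometrically.

    On a cylinder of radius r, duration h and half-oscillation om, the terms u_t
    and |Du|^q balance when h (om / r)^q = lam om for a fixed number lam.  As
    q > 2, the diffusion, of relative size h / r^2, and the constants etam and
    etap are then negligible on small cylinders, provided that om decays no
    faster than a small power of r.  Let m be the middle value of u on such a
    cylinder and look at the bottom.  Either u <= m at some point near the
    centre, or u > m at all of them.
    - In the first case the coercivity of H in the subsolution inequality
      spreads the low value: u lies below a barrier which is a regularised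
      multiple of |x - y|^2 / (t - t1)^(p / 2) plus a slowly growing function of
      time, and at the final times this barrier is below m + 3/4 om on a smaller
      ball ([low_value_spreads]).
    - In the second case the growth bound on H in the supersolution inequality
      limits the speed at which u can decrease, and u stays above
      m - (1 - gm) om on a smaller ball for the whole duration
      ([high_values_persist]).
    In both cases the oscillation drops by the fixed factor 1 - gm / 2
    ([oscillation_decay]).

    Both barriers are paraboloids A(t) |x - y|^2 + B(t).  Their gradient is
    radial and their Hessian is scalar, so that a enters through its trace
    only, and the comparison of u with them ([comparison]) needs no doubling of
    variables.  The exponent p / 2 of the first barrier is the one for which its
    time derivative, its gradient term and its diffusion term carry the same
    power of t - t1 where |x - y|^2 is comparable to t - t1
    ([powR_selfsimilar]); this power is integrable because p < 2.

    Iterating with r_n = r 16^-n, om_n = M gamma^n, h_n = h nu^n and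
    gamma = 16^-alpha, the balance forces nu = 16^-(q - alpha (q - 1)).  This
    is the Hoelder exponent alpha in space and alpha / (q - alpha (q - 1)) in
    time, that is (theta - p) / (theta - 1) and (theta - p) / theta for
    theta = (p - alpha) / (1 - alpha). *)

(** * Paraboloids as test functions *)

Section Paraboloids.
Context {R : realType} {N : nat}.
Implicit Types (x y z : 'rV[R]_N) (A B : R -> R) (w : 'rV[R]_N * R).

Definition sqnorm x : R := \sum_i x 0 i ^+ 2.

Lemma frobeniusE x : frobenius x = Num.sqrt (sqnorm x).
Proof.
rewrite /frobenius /mxtrace big_ord1 mxE; congr Num.sqrt.
by apply: eq_bigr => i _; rewrite mxE expr2.
Qed.

Lemma sqnorm_ge0 x : 0 <= sqnorm x.
Proof. by apply: sumr_ge0 => i _; exact: sqr_ge0. Qed.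

Lemma sqnorm0 : sqnorm 0 = 0.
Proof. by rewrite /sqnorm big1// => i _; rewrite mxE expr0n. Qed.

Lemma sqnormN x : sqnorm (- x) = sqnorm x.
Proof. by apply: eq_bigr => i _; rewrite mxE sqrrN. Qed.

Lemma sqr_frobenius x : frobenius x ^+ 2 = sqnorm x.
Proof. by rewrite frobeniusE sqr_sqrtr// sqnorm_ge0. Qed.

Lemma frobenius_ge0 m n (X : 'M[R]_(m, n)) : 0 <= frobenius X.
Proof. exact: sqrtr_ge0. Qed.

Lemma frobenius_eq0 x : frobenius x = 0 -> x = 0.
Proof.
move=> x0; have : sqnorm x = 0 by rewrite -sqr_frobenius x0 expr0n.
move/eqP; rewrite psumr_eq0 => [/allP xi0|i _]; last exact: sqr_ge0.
apply/rowP => i; rewrite mxE; apply/eqP.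
by rewrite -sqrf_eq0; apply: xi0; rewrite mem_index_enum.
Qed.

Lemma frobeniusZ (k : R) x : frobenius (k *: x) = `|k| * frobenius x.
Proof.
rewrite !frobeniusE -sqrtr_sqr -sqrtrM ?sqr_ge0//; congr Num.sqrt.
by rewrite /sqnorm mulr_sumr; apply: eq_bigr => i _; rewrite mxE exprMn.
Qed.

(** A substitute for the triangle inequality that avoids square roots; the lost
    factor is absorbed in the choice of the radii of nested balls. *)
Lemma sqnormD_le x y : sqnorm (x + y) <= 2 * sqnorm x + 2 * sqnorm y.
Proof.
rewrite /sqnorm !mulr_sumr -big_split/=; apply: ler_sum => i _.
by rewrite mxE; have := sqr_ge0 (x 0 i - y 0 i); lra.
Qed.

Lemma sqnorm_line x i (h : R) :
  sqnorm (h *: delta_mx 0 i + x) = sqnorm x + 2 * h * x 0 i + h ^+ 2.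
Proof.
rewrite /sqnorm (bigD1 i)//= [in RHS](bigD1 i)//= !mxE !eqxx mulr1.
rewrite (eq_bigr (fun j => x 0 j ^+ 2)); first by ring.
by move=> j ji; rewrite !mxE eqxx/= (negbTE ji) mulr0 add0r.
Qed.

Lemma continuous_sqnorm : continuous sqnorm.
Proof.
move=> x; rewrite /continuous_at /sqnorm.
apply: (@cvg_big _ _ +%R 0 xpredT _ _ (nbhs x)) => [|i _].
  exact: add_continuous.
under eq_fun do rewrite expr2.
rewrite expr2; apply: cvgM; exact: coord_continuous.
Qed.

Definition paraboloid A B y w : R := A w.2 * sqnorm (w.1 - y) + B w.2.

(** The derivative is part of the data, so that the equation on a paraboloid
    becomes an explicit expression in A, A', B and B'. *)
Definition C1 (f f' : R -> R) : Prop :=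
  (forall t, is_derive t (1 : R) f (f' t)) /\ continuous f'.

Lemma C1_continuous f f' : C1 f f' -> continuous f.
Proof.
move=> [df _] t; apply: differentiable_continuous.
by apply/derivable1_diffP; case: (df t).
Qed.

Variables (A A' B B' : R -> R) (y : 'rV[R]_N).
Hypotheses (C1A : C1 A A') (C1B : C1 B B').

Let phi := paraboloid A B y.

Lemma is_derive_paraboloid_t w :
  is_derive w.2 (1 : R) (fun t => phi (w.1, t))
    (A' w.2 * sqnorm (w.1 - y) + B' w.2).
Proof.
rewrite /phi /paraboloid /=; have dA := C1A.1 w.2; have dB := C1B.1 w.2.
set c := sqnorm _.
rewrite (_ : (fun t => _) = A * cst c + B); last by apply/funext.
by apply: is_derive_eq; rewrite scaler0 add0r /GRing.scale/= mulrC.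
Qed.

Lemma is_derive_paraboloid_x i w :
  is_derive w.1 (delta_mx 0 i) (fun x => phi (x, w.2))
    (2 * A w.2 * (w.1 - y) 0 i).
Proof.
have lim : h^-1 *: ((fun x => phi (x, w.2)) (h *: delta_mx 0 i + w.1) -
    phi (w.1, w.2)) @[h --> (0 : R)^'] --> 2 * A w.2 * (w.1 - y) 0 i.
  have -> : 2 * A w.2 * (w.1 - y) 0 i = 2 * A w.2 * (w.1 - y) 0 i + A w.2 * 0.
    by rewrite mulr0 addr0.
  have : 2 * A w.2 * (w.1 - y) 0 i + A w.2 * h @[h --> (0 : R)^'] -->
      2 * A w.2 * (w.1 - y) 0 i + A w.2 * 0.
    apply: cvgD; first exact: cvg_cst.
    by apply: cvgM; [exact: cvg_cst|exact: nbhs_dnbhs].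
  apply: cvg_trans; apply: near_eq_cvg; near=> h.
  have h0 : h != 0 by near: h; exact: nbhs_dnbhs_neq.
  rewrite /phi /paraboloid/= -(addrA (h *: _)) sqnorm_line /GRing.scale/=.
  by field.
by apply: DeriveDef; [apply/cvg_ex; eexists; exact: lim|exact: cvg_lim lim].
Unshelve. all: by end_near. Qed.

Lemma dt_paraboloid : dt phi = fun w => A' w.2 * sqnorm (w.1 - y) + B' w.2.
Proof.
apply/funext => w; rewrite /dt derive1E.
by have [_ ->] := is_derive_paraboloid_t w.
Qed.

Lemma dx_paraboloid i : dx i phi = fun w => 2 * A w.2 * (w.1 - y) 0 i.
Proof.
by apply/funext => w; rewrite /dx; have [_ ->] := is_derive_paraboloid_x i w.
Qed.

Lemma is_derive_dx_paraboloid i j w :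
  is_derive w.1 (delta_mx 0 j) (fun x => dx i phi (x, w.2))
    (2 * A w.2 *+ (i == j)).
Proof.
rewrite dx_paraboloid/=.
have lim : h^-1 *: ((fun x => 2 * A w.2 * (x - y) 0 i)
    (h *: delta_mx 0 j + w.1) -
    2 * A w.2 * (w.1 - y) 0 i) @[h --> (0 : R)^'] --> 2 * A w.2 *+ (i == j).
  have : cst (2 * A w.2 *+ (i == j)) h @[h --> (0 : R)^'] -->
     2 * A w.2 *+ (i == j) by exact: cvg_cst.
  apply: cvg_trans; apply: near_eq_cvg; near=> h.
  have h0 : h != 0 by near: h; exact: nbhs_dnbhs_neq.
  rewrite !mxE eqxx/= /GRing.scale/= -mulr_natr.
  by field.
by apply: DeriveDef; [apply/cvg_ex; eexists; exact: lim|exact: cvg_lim lim].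
Unshelve. all: by end_near. Qed.

Lemma hessx_paraboloid w : hessx phi w = (2 * A w.2)%:M.
Proof.
apply/matrixP => i j; rewrite !mxE /dx.
by have [_ ->] := is_derive_dx_paraboloid i j w.
Qed.

Lemma gradx_paraboloid w : gradx phi w = (2 * A w.2) *: (w.1 - y).
Proof. by apply/rowP => i; rewrite mxE dx_paraboloid !mxE. Qed.

Lemma cvg_sndf (f : R -> R) w : continuous f -> f v.2 @[v --> w] --> f w.2.
Proof. by move=> cf; apply: (cvg_comp _ f cvg_snd); exact: cf. Qed.

Lemma cvg_subf w : v.1 - y @[v --> w] --> w.1 - y.
Proof. by apply: cvgB; [exact: cvg_fst|exact: cvg_cst]. Qed.

Lemma cvg_sqnorm_sub w : sqnorm (v.1 - y) @[v --> w] --> sqnorm (w.1 - y).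
Proof.
by apply: (cvg_comp _ sqnorm (@cvg_subf w)); exact: continuous_sqnorm.
Qed.

Lemma continuous_quadratic (f g : R -> R) : continuous f -> continuous g ->
  continuous (paraboloid f g y).
Proof.
move=> cf cg w; apply: cvgD; last exact: cvg_sndf.
by apply: cvgM; [exact: cvg_sndf|exact: cvg_sqnorm_sub].
Qed.

Lemma continuous_paraboloid : continuous phi.
Proof. by apply: continuous_quadratic; apply: C1_continuous; eassumption. Qed.

Lemma C21_paraboloid (S : set ('rV[R]_N * R)) : C21 S phi.
Proof.
split=> [||i|i j].
- exact/continuous_subspaceT/continuous_paraboloid.
- split=> [w _|]; first by case: (is_derive_paraboloid_t w).
  apply: continuous_subspaceT; rewrite dt_paraboloid.
  by apply: continuous_quadratic; [exact: C1A.2|exact: C1B.2].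
- split=> [w _|]; first by case: (is_derive_paraboloid_x i w).
  apply: continuous_subspaceT => w; rewrite dx_paraboloid.
  apply: cvgM; first apply: cvgM; first exact: cvg_cst.
    by apply: cvg_sndf; exact: C1_continuous C1A.
  apply: (cvg_comp _ (fun x : 'rV_N => x 0 i) (@cvg_subf w)).
  exact: coord_continuous.
- split=> [w _|]; first by case: (is_derive_dx_paraboloid i j w).
  apply: continuous_subspaceT => w.
  have -> : dx j (dx i phi) = fun w => 2 * A w.2 *+ (i == j).
    apply/funext => v; rewrite /dx.
    by have [_ ->] := is_derive_dx_paraboloid i j v.
  apply: cvgMn; apply: cvgM; first exact: cvg_cst.
  by apply: cvg_sndf; exact: C1_continuous C1A.
Qed.

End Paraboloids.

(** * Viscosity solutions tested on paraboloids *)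

Section Comparison.
Context {R : realType} {N : nat}.
Implicit Types (v : 'rV[R]_N * R -> R) (w : 'rV[R]_N * R) (y : 'rV[R]_N).

Lemma within_continuous_near (S : set ('rV[R]_N * R)) v w (e : R) :
  {within S, continuous v} -> S w -> 0 < e ->
  \forall z \near w, S z -> `|v w - v z| < e.
Proof.
move=> cv Sw e0; have /cvgrPdist_lt/(_ _ e0) := cv w.
have [_|/(_ Sw)//] := nbhs_subspaceP S w.
by rewrite near_withinE.
Qed.

(** What is left of the subsolution property when only paraboloids are used as
    test functions: d stands for the trace of the diffusion matrix, and G for a
    radial lower bound of the Hamiltonian.  Both u and - u have this property,
    with different G, and one comparison principle serves them both. *)
Definition paraboloid_subsolution (T K : R) (G : R -> R) v : Prop :=
  forall A A' B B' y, C1 A A' -> C1 B B' -> forall w, open_strip T w ->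
  (\forall z \near w,
    v z - paraboloid A B y z <= v w - paraboloid A B y w) ->
  exists2 d, 0 <= d <= K &
    A' w.2 * sqnorm (w.1 - y) + B' w.2 - 2 * A w.2 * d
      + G (2 * `|A w.2| * frobenius (w.1 - y)) <= 0.

Lemma mxtrace_gram_ge0 m n (X : 'M[R]_(m, n)) : 0 <= \tr (X *m X^T).
Proof.
by apply: sumr_ge0 => i _; rewrite mxE; apply: sumr_ge0 => j _;
  rewrite mxE -expr2 sqr_ge0.
Qed.

Section FromViscosity.
Variables (D : nat) (T q delta etam etap : R).
Variables (H : 'rV[R]_N -> R -> 'rV[R]_N -> R).
Variables (sigma : 'rV[R]_N * R -> 'M[R]_(N, D)).
Hypothesis delta0 : 0 <= delta.
Hypothesis Hgrowth : forall x t z, 0 < t < T ->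
  delta^-1 * frobenius z `^ q - etam <= H x t z
    <= delta * frobenius z `^ q + etap.
Hypothesis sigma_le : forall w, open_strip T w -> frobenius (sigma w) <= delta.

Let a w := sigma w *m (sigma w)^T.

Lemma mxtrace_diffusion_itv w : open_strip T w -> 0 <= \tr (a w) <= delta ^+ 2.
Proof.
move=> Tw; rewrite mxtrace_gram_ge0/= -[leLHS]sqr_sqrtr ?mxtrace_gram_ge0//.
by rewrite ler_pXn2r// ?nnegrE ?sqrtr_ge0//; exact: sigma_le.
Qed.

Lemma HJ_operator_paraboloid A A' B B' y w : C1 A A' -> C1 B B' ->
  HJ_operator a H (paraboloid A B y) w =
    A' w.2 * sqnorm (w.1 - y) + B' w.2 - 2 * A w.2 * \tr (a w)
      + H w.1 w.2 ((2 * A w.2) *: (w.1 - y)).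
Proof.
move=> C1A C1B; rewrite /HJ_operator (dt_paraboloid y C1A C1B).
by rewrite hessx_paraboloid gradx_paraboloid mul_mx_scalar mxtraceZ.
Qed.

Lemma frobenius_slope (k : R) y :
  frobenius ((2 * k) *: y) = 2 * `|k| * frobenius y.
Proof. by rewrite frobeniusZ normrM ger0_norm. Qed.

Lemma subsolution_paraboloid u : viscosity_subsolution T a H u ->
  paraboloid_subsolution T (delta ^+ 2) (fun s => delta^-1 * s `^ q - etam) u.
Proof.
move=> subu A A' B B' y C1A C1B w Tw umax.
exists (\tr (a w)); first exact: mxtrace_diffusion_itv.
have := subu _ (C21_paraboloid y C1A C1B (open_strip T)) w Tw umax.
rewrite (HJ_operator_paraboloid y w C1A C1B).
have /andP[+ _] := Hgrowth w.1 ((2 * A w.2) *: (w.1 - y)) Tw.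
by rewrite frobenius_slope; lra.
Qed.

Lemma C1N (f f' : R -> R) : C1 f f' -> C1 (fun t => - f t) (fun t => - f' t).
Proof.
move=> [df cf']; split=> [t|t]; first by have dft := df t; exact: is_deriveN.
by apply: cvgN; exact: cf'.
Qed.

(** A paraboloid touching - u from above is the opposite of one that touches u
    from below. *)
Lemma supersolution_paraboloid u : viscosity_supersolution T a H u ->
  paraboloid_subsolution T (delta ^+ 2) (fun s => - (delta * s `^ q) - etap)
    (fun w => - u w).
Proof.
move=> superu A A' B B' y C1A C1B w Tw umax.
exists (\tr (a w)); first exact: mxtrace_diffusion_itv.
have C1NA := C1N C1A; have C1NB := C1N C1B.
have parN z :
    paraboloid (fun t => - A t) (fun t => - B t) y z = - paraboloid A B y z.
  by rewrite /paraboloid mulNr opprD.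
have := superu _ (C21_paraboloid y C1NA C1NB (open_strip T)) w Tw.
rewrite (HJ_operator_paraboloid y w C1NA C1NB).
have /andP[_] := Hgrowth w.1 ((2 * - A w.2) *: (w.1 - y)) Tw.
rewrite frobenius_slope normrN => Hle super.
have {super} : 0 <= - A' w.2 * sqnorm (w.1 - y) + - B' w.2
    - 2 * - A w.2 * \tr (a w) + H w.1 w.2 ((2 * - A w.2) *: (w.1 - y)).
  apply: super; near=> z; rewrite !parN.
  have : - u z - paraboloid A B y z <= - u w - paraboloid A B y w.
    by near: z.
  by lra.
lra.
Unshelve. all: by end_near. Qed.

End FromViscosity.

(** * Comparison with strict paraboloid supersolutions *)

Lemma continuous_sqnorm_sub y : continuous (fun x : 'rV[R]_N => sqnorm (x - y)).
Proof.
move=> x; apply: (cvg_comp (fun x : 'rV[R]_N => x - y) sqnorm); last first.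
  exact: continuous_sqnorm.
apply: (@cvgB _ _ _ (nbhs x) (nbhs_filter x) id (cst y)).
  exact: cvg_id.
exact: cvg_cst.
Qed.

Lemma closed_sqnorm_ball y (c : R) : closed [set x | sqnorm (x - y) <= c].
Proof.
have := @preimage_closed _ _ (fun x : 'rV[R]_N => sqnorm (x - y)) _ _
  (@closed_le R c).
apply; move=> x _; exact: continuous_sqnorm_sub.
Qed.

Lemma norm_le_frobenius y : `|y| <= frobenius y.
Proof.
rewrite [leLHS]/Num.norm/= mx_normrE; apply: bigmax_le => [|[i j] _ /=].
  exact: frobenius_ge0.
rewrite frobeniusE -sqrtr_sqr ler_sqrt ?sqnorm_ge0//.
rewrite (ord1 i) /sqnorm (bigD1 j)//= lerDl.
by apply: sumr_ge0 => k _; exact: sqr_ge0.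
Qed.

Lemma compact_sqnorm_ball y (c : R) : compact [set x | sqnorm (x - y) <= c].
Proof.
apply: bounded_closed_compact; last exact: closed_sqnorm_ball.
rewrite /bounded_set /bounded_near; near=> b => x /= xyc.
have xyE : `|x - y| <= Num.sqrt c.
  apply: (le_trans (norm_le_frobenius _)).
  by rewrite frobeniusE ler_sqrt// (le_trans (sqnorm_ge0 _) xyc).
have : `|x| <= `|x - y| + `|y| by rewrite -{1}(subrK y x) ler_normD.
move/le_trans; apply; apply: (le_trans (lerD xyE (lexx _))).
by near: b; exact: nbhs_pinfty_ge.
Unshelve. all: by end_near. Qed.

Lemma near_sqnorm_cylinder y (c t1 t2 : R) w :
  sqnorm (w.1 - y) < c -> t1 < w.2 < t2 ->
  \forall z \near w, sqnorm (z.1 - y) < c /\ t1 < z.2 < t2.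
Proof.
move=> wc /andP[t1w wt2]; near=> z; split; [|apply/andP; split].
- near: z; apply: (cvgr_lt (sqnorm (w.1 - y))) => //.
  by apply: (cvg_comp fst (fun x : 'rV[R]_N => sqnorm (x - y)) cvg_fst);
    exact: continuous_sqnorm_sub.
- by near: z; apply: (cvgr_gt w.2) => //; exact: cvg_snd.
- by near: z; apply: (cvgr_lt w.2) => //; exact: cvg_snd.
Unshelve. all: by end_near. Qed.

Lemma C1D (f f' g g' : R -> R) : C1 f f' -> C1 g g' ->
  C1 (fun t => f t + g t) (fun t => f' t + g' t).
Proof.
move=> [df cf] [dg cg]; split=> t.
  by have dft := df t; have dgt := dg t; exact: is_deriveD.
by apply: cvgD; [exact: cf|exact: cg].
Qed.

Lemma C1M (f f' g g' : R -> R) : C1 f f' -> C1 g g' ->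
  C1 (fun t => f t * g t) (fun t => f' t * g t + f t * g' t).
Proof.
move=> C1f C1g; have [df cf] := C1f; have [dg cg] := C1g; split=> t.
  have dft := df t; have dgt := dg t.
  rewrite (_ : (fun t => _) = f * g)//.
  by apply: is_derive_eq; rewrite /GRing.scale/=; ring.
apply: cvgD; apply: cvgM; first exact: cf.
- exact: (C1_continuous C1g).
- exact: (C1_continuous C1f).
- exact: cg.
Qed.

Lemma C1_cst (k : R) : C1 (fun=> k) (fun=> 0).
Proof. by split=> t; [exact: is_derive_cst|exact: cvg_cst]. Qed.

Lemma C1_affine (k s : R) : C1 (fun t => k * (t - s)) (fun=> k).
Proof.
split=> t; last exact: cvg_cst.
rewrite (_ : (fun t => _) = k \*: (id - cst s)); last by apply/funext.
by apply: is_derive_eq; rewrite subr0 /GRing.scale/= mulr1.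
Qed.

Lemma C1_expR : C1 (@expR R) expR.
Proof. by split=> t; [exact: is_derive_expR|exact: continuous_expR]. Qed.

Lemma C1_comp (f f' g g' : R -> R) : C1 f f' -> C1 g g' ->
  C1 (fun t => f (g t)) (fun t => f' (g t) * g' t).
Proof.
move=> [df cf] C1g; have [dg cg] := C1g; split=> t.
  have := is_derive1_comp (df (g t)) (dg t).
  by rewrite /comp mulrC.
apply: cvgM; last exact: cg.
by apply: (cvg_comp _ f' (C1_continuous C1g (x := t))); exact: cf.
Qed.

Lemma C1_powR (a : R) (f f' : R -> R) : (forall t, 0 < f t) -> C1 f f' ->
  C1 (fun t => f t `^ a) (fun t => a * f t `^ (a - 1) * f' t).
Proof.
move=> f0 C1f; have [df cf] := C1f; split=> t.
  have := is_derive1_comp (is_derive1_powR a (f0 t)) (df t).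
  by rewrite /comp mulrC.
apply: cvgM; last exact: cf.
apply: cvgM; first exact: cvg_cst.
have cpow : {for f t, continuous (fun s : R => s `^ (a - 1))}.
  apply: differentiable_continuous; apply/derivable1_diffP.
  by have [] := is_derive1_powR (a - 1) (f0 t).
have := cvg_comp _ _ (C1_continuous C1f (x := t)) cpow; exact.
Qed.

Lemma exists_expR_gt (e M h : R) : 0 < e -> 0 < h ->
  exists2 n, 0 <= n & M < e * expR (n * h).
Proof.
move=> e0 h0; exists (`|M| / (e * h)).
  by rewrite divr_ge0// mulr_ge0 ?ltW.
rewrite -ltr_pdivrMl//.
apply: lt_le_trans (expR_ge1Dx _).
have -> : `|M| / (e * h) * h = e^-1 * `|M| by field; rewrite !gt_eqF.
rewrite (@le_lt_trans _ _ (e^-1 * `|M|))//; last by rewrite ltrDr.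
by rewrite ler_pM2l ?invr_gt0// ler_norm.
Qed.

Section ComparisonPrinciple.
Variables (T K : R) (G : R -> R) (v : 'rV[R]_N * R -> R).
Variables (A A' B B' : R -> R) (y : 'rV[R]_N) (c t1 t2 : R).
Hypothesis subv : paraboloid_subsolution T K G v.
Hypothesis cv : {within closed_strip 0 T, continuous v}.
Hypotheses (C1A : C1 A A') (C1B : C1 B B').
Hypotheses (t1_ge0 : 0 <= t1) (t1t2 : t1 < t2) (t2T : t2 <= T).
Hypothesis strict : forall x t d, t1 < t < t2 -> sqnorm (x - y) < c ->
  0 <= d <= K ->
  0 < A' t * sqnorm (x - y) + B' t - 2 * A t * d
      + G (2 * `|A t| * frobenius (x - y)).
Hypothesis bottom : forall x, sqnorm (x - y) <= c ->
  v (x, t1) <= paraboloid A B y (x, t1).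
Hypothesis lateral : forall x t, t1 <= t <= t2 -> sqnorm (x - y) = c ->
  v (x, t) <= paraboloid A B y (x, t).

Let Q : set ('rV[R]_N * R) :=
  [set x | sqnorm (x - y) <= c] `*` [set t | t1 <= t <= t2].

Let phi := paraboloid A B y.

Let QT : Q `<=` closed_strip 0 T.
Proof.
move=> [x t] [_ /= /andP[t1t tt2]]; rewrite /closed_strip/=.
by rewrite (le_trans t1_ge0 t1t) (le_trans tt2 t2T).
Qed.

Let compactQ : compact Q.
Proof.
apply: compact_setX; first exact: compact_sqnorm_ball.
exact: (@segment_compact R t1 t2).
Qed.

Let maximum (f f' : R -> R) : Q !=set0 -> C1 f f' ->
  exists2 w, Q w & forall z, Q z ->
    v z - paraboloid A f y z <= v w - paraboloid A f y w.
Proof.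
move=> Q0 C1f.
have cvQ : {within Q, continuous v} by exact: continuous_subspaceW QT cv.
have cphi : {within Q, continuous paraboloid A f y}.
  apply: continuous_subspaceT.
  exact: continuous_paraboloid C1A C1f.
have [w /set_mem Qw wmax] :=
  compact_EVT_max Q0 compactQ (within_continuousB cvQ cphi).
by exists w => // z Qz; apply: wmax; exact/mem_set.
Qed.

(** The penalty equals e at time t and exceeds the maximum of v - phi at time
    t2, so that a positive maximum of the penalised difference cannot sit on the
    top of the cylinder; it increases in time, which preserves the strict
    inequality. *)
Let below_top x t : t1 <= t < t2 -> sqnorm (x - y) <= c ->
  v (x, t) <= phi (x, t).
Proof.
move=> /andP[t1t tt2] xc; rewrite leNgt; apply/negP => gt_phi.
have Qxt : Q (x, t) by split=> //=; rewrite t1t ltW.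
have Q0 : Q !=set0 by exists (x, t).
have [m _ mmax] := maximum Q0 C1B.
pose e := (v (x, t) - phi (x, t)) / 2.
have e0 : 0 < e by rewrite divr_gt0// subr_gt0.
have h0 : 0 < t2 - t by rewrite subr_gt0.
have [n n0 top] := exists_expR_gt (v m - phi m) e0 h0.
have C1Be :=
  C1D C1B (C1M (C1_cst e) (C1_comp C1_expR (C1_affine n t))).
have [w Qw wmax] := maximum Q0 C1Be.
have parE z : paraboloid A (fun s => B s + e * expR (n * (s - t))) y z =
    phi z + e * expR (n * (z.2 - t)).
  by rewrite /phi /paraboloid addrA.
have w_gt0 : 0 < v w - (phi w + e * expR (n * (w.2 - t))).
  have := wmax _ Qxt; rewrite !parE /= subrr mulr0 expR0 mulr1.
  by apply: lt_le_trans; rewrite /e; lra.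
have pen_gt0 : 0 < e * expR (n * (w.2 - t)) by rewrite mulr_gt0 ?expR_gt0.
have [/= wc /andP[t1w wt2]] := Qw.
have ww : w = (w.1, w.2) by case: (w).
have {t1w} t1w : t1 < w.2.
  rewrite lt_neqAle t1w andbT; apply/eqP => t1E.
  by have := bottom wc; rewrite t1E -ww -/phi; lra.
have {wt2} wt2 : w.2 < t2.
  rewrite lt_neqAle wt2 andbT; apply/eqP => t2E.
  by have := mmax _ Qw; rewrite -/phi; move: w_gt0 top; rewrite t2E; lra.
have {wc} wc : sqnorm (w.1 - y) < c.
  rewrite lt_neqAle wc andbT; apply/eqP => cE.
  have t12w : t1 <= w.2 <= t2 by rewrite !ltW.
  by have := lateral t12w cE; rewrite -ww -/phi; lra.
have t12w : t1 < w.2 < t2 by rewrite t1w.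
have [||d d0K] := subv (y := y) C1A C1Be (w := w).
- by rewrite /open_strip/= (le_lt_trans t1_ge0 t1w) (lt_le_trans wt2 t2T).
- apply: filterS (near_sqnorm_cylinder wc t12w) => z [zc /andP[t1z zt2]].
  by apply: wmax; split=> /=; [exact: ltW|rewrite !ltW].
have := strict t12w wc d0K => /=.
have : 0 <= e * (expR (n * (w.2 - t)) * n).
  by rewrite mulrA mulr_ge0// ltW.
lra.
Qed.

(** An interior maximum of v - phi contradicts the strict inequality at once,
    since the paraboloid phi is itself an admissible test function.  The top of
    the cylinder, where the equation gives nothing if t2 = T, is first avoided
    by a penalty in time and then recovered by continuity. *)
Lemma comparison x t : t1 <= t <= t2 -> sqnorm (x - y) <= c ->
  v (x, t) <= paraboloid A B y (x, t).
Proof.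
move=> /andP[t1t]; rewrite le_eqVlt => /predU1P[->|tt2] xc; last first.
  by apply: below_top => //; rewrite t1t.
rewrite leNgt; apply/negP; rewrite -subr_gt0 => gt_phi.
have cvphi : {within closed_strip 0 T, continuous (v - phi)}.
  apply: within_continuousB => //.
  apply: continuous_subspaceT.
  exact: continuous_paraboloid C1A C1B.
have strip : closed_strip 0 T (x, t2).
  by rewrite /closed_strip/= t2T (le_trans t1_ge0 (ltW t1t2)).
have near_xt2 := within_continuous_near cvphi strip gt_phi.
have near_t2 : \forall s \near t2^'-, closed_strip 0 T (x, s) ->
    `|(v - phi) (x, t2) - (v - phi) (x, s)| < v (x, t2) - phi (x, t2).
  case: near_xt2 => -[U V] /= [/nbhs_singleton Ux Vt2] UV.
  have := @cvg_at_left_filter _ _ id t2 t2 cvg_id _ Vt2.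
  by apply: filterS => s Vs; exact: (UV (x, s)).
have : \forall s \near t2^'-, False.
  near=> s; have t1s : t1 <= s.
    by near: s; apply: filterS (nbhs_left_gt t1t2) => s /ltW.
  have st2 : s < t2 by near: s; exact: nbhs_left_lt.
  have strip_s : closed_strip 0 T (x, s).
    by rewrite /closed_strip/= (le_trans t1_ge0 t1s) (le_trans (ltW st2) t2T).
  have : `|(v - phi) (x, t2) - (v - phi) (x, s)| < v (x, t2) - phi (x, t2).
    by move: strip_s; near: s.
  have vphiE z : (v - phi) z = v z - phi z by [].
  have : v (x, s) <= phi (x, s) by apply: below_top => //; rewrite t1s.
  by move=> ? /ltr_normlW; rewrite !vphiE; lra.
by case/filter_ex.
Unshelve. all: by end_near. Qed.

End ComparisonPrinciple.

End Comparison.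
(** * The differential inequality of the spreading barrier *)

Section PowerInequalities.
Context {R : realType}.
Implicit Types p q : R.

Lemma conjugate_exponent p q : 2 < q -> p^-1 + q^-1 = 1 ->
  [/\ 1 < p, p < 2 & p * q = p + q].
Proof.
move=> q2 pq; have q0 : q != 0 by apply/negP => /eqP; clear pq; lra.
have q10 : q - 1 != 0 by apply/negP => /eqP; clear pq; lra.
have -> : p = q / (q - 1).
  rewrite -[LHS]invrK (_ : p^-1 = 1 - q^-1); last by rewrite -pq addrK.
  by field; rewrite q0 q10.
clear pq; split; last by field.
- by rewrite ltr_pdivlMr; lra.
- by rewrite ltr_pdivrMr; lra.
Qed.

(** Here s is the elapsed time and s^(-p/2) rho the size of the gradient of the
    barrier.  Conjugacy makes the q-th power of the gradient carry the same
    factor s^(-p/2) as the other terms of the inequality, which leaves a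
    function of the similarity variable rho^2 / s. *)
Lemma powR_selfsimilar p q (s rho : R) : p * q = p + q -> 0 < s -> 0 <= rho ->
  (s `^ (- (p / 2)) * rho) `^ q =
    s `^ (- (p / 2)) * (rho ^+ 2 / s) `^ (q / 2).
Proof.
move=> pqM s0 rho0; have si0 : 0 <= s^-1 by rewrite invr_ge0 ltW.
rewrite powRM ?powR_ge0// powRM ?sqr_ge0//.
have -> : (rho ^+ 2) `^ (q / 2) = rho `^ q.
  by rewrite -powR_mulrn// -powRrM; congr (_ `^ _); field.
have -> : s^-1 `^ (q / 2) = s `^ (- (q / 2)).
  by rewrite -powR_inv1 ?ltW// -powRrM mulN1r.
rewrite -powRrM mulrCA -powRD; last by apply/implyP => _; rewrite gt_eqF.
by rewrite (_ : - (p / 2) + - (q / 2) = - (p / 2) * q) 1?mulrC//; lra.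
Qed.

(** The superlinear term xi^(q/2) absorbs a linear term beyond a threshold, and
    the constant g / 2 absorbs it below.  This is where q > 2 enters. *)
Lemma powR_dominates q g (xi : R) : 2 < q -> 0 < g -> 0 <= xi ->
  5 * xi <= g / 2 + 5 * (g / 10) `^ (1 - q / 2) * xi `^ (q / 2).
Proof.
move=> q2 g0 xi0; have g10 : 0 < g / 10 by rewrite divr_gt0.
set L := (g / 10) `^ _; have L0 : 0 < L by exact: powR_gt0.
have term0 : 0 <= L * xi `^ (q / 2) by rewrite mulr_ge0 ?powR_ge0// ltW.
have [xi_le|xi_gt] := leP xi (g / 10); first by lra.
suff : xi <= L * xi `^ (q / 2) by lra.
have -> : xi `^ (q / 2) = xi * xi `^ (q / 2 - 1).
  by rewrite mulr_powRB1 ?ltW//; lra.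
rewrite mulrCA ler_peMr//.
have LE : L * (g / 10) `^ (q / 2 - 1) = 1.
  rewrite -powRD; last by apply/implyP => _; rewrite gt_eqF.
  by rewrite (_ : _ + _ = 0) ?powRr0//; ring.
rewrite -[leLHS]LE ler_pM2l//.
by apply: ge0_ler_powR; rewrite ?nnegrE; lra.
Qed.

Lemma powR_near1_ge p (s : R) : 1 < p -> p < 2 -> 0 < s -> s ^+ 2 <= 5 / 4 ->
  4 / 5 <= s `^ (- (p / 2)).
Proof.
move=> p1 p2 s0 s54; rewrite powRN.
have -> : 4 / 5 = (5 / 4 : R)^-1 by field.
rewrite lef_pV2 ?posrE ?powR_gt0 ?divr_gt0//.
have [s1|s1] := leP 1 s.
  by apply: le_trans (ler1_powR s1 _) _; [lra|nra].
have : s `^ (p / 2) <= 1 `^ (p / 2).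
  by apply: ge0_ler_powR; rewrite ?nnegrE; lra.
by rewrite powR1; lra.
Qed.

Lemma powR_half_le p (s : R) : 1 < p -> p < 2 -> 1 / 2 <= s ->
  s `^ (- (p / 2)) <= 2.
Proof.
move=> p1 p2 s2; have s0 : 0 < s by lra.
rewrite powRN -[leRHS]invrK lef_pV2 ?posrE ?powR_gt0 ?invr_gt0// -[leLHS]div1r.
have half : 0 < (1 / 2 : R) <= 1 by rewrite divr_gt0//=; lra.
have p2_le1 : p / 2 <= 1 by lra.
have half_le : (1 / 2 : R) <= (1 / 2) `^ (p / 2) by exact: ger1_powR.
apply: (le_trans half_le).
by apply: ge0_ler_powR; rewrite ?nnegrE; lra.
Qed.

(** The barrier is a strict supersolution, in dimensionless variables: th is the
    elapsed time, s its regularisation, rho the distance to the low point and P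
    the factor s^(-p/2).  The decrease of P costs 5 rho^2 / s times P at most,
    which the gradient term and half of the growth of th P compensate; the other
    half beats the diffusion D and the constant E. *)
Lemma descent_inequality p q g L (s th rho D E P : R) :
    1 < p -> p < 2 -> 2 < q -> p * q = p + q ->
    0 < g -> g <= (1 - p / 2) / 8 -> 5 * (g / 10) `^ (1 - q / 2) <= L ->
    0 < s -> 0 <= th <= s -> s ^+ 2 <= 5 / 4 -> 0 <= rho ->
    D <= g / 80 -> E <= g / 16 ->
    P = s `^ (- (p / 2)) ->
  0 < - (5 * (p / 2) * th * (P / s ^+ 2) * rho ^+ 2)
      + (P - p / 2 * th ^+ 2 * (P / s ^+ 2)) / 8
      - 10 * P * D + L * (10 * P * rho) `^ q - E.
Proof.
move=> p1 p2 q2 pqM g0 gp gL s0 /andP[th0 ths] s54 rho0 DK EK PE.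
have selfsim := powR_selfsimilar pqM s0 rho0; clear pqM.
have P0 : 0 < P by rewrite PE powR_gt0.
have P45 : 4 / 5 <= P by rewrite PE powR_near1_ge.
have Prho0 : 0 <= P * rho by rewrite mulr_ge0// ltW.
pose xi := rho ^+ 2 / s.
have xi0 : 0 <= xi by rewrite divr_ge0 ?sqr_ge0// ltW.
have grad : P * (5 * xi - g / 2) <= L * (10 * P * rho) `^ q.
  have gP : 0 <= 5 * (g / 10) `^ (1 - q / 2) by rewrite mulr_ge0 ?powR_ge0.
  apply: (@le_trans _ _ (5 * (g / 10) `^ (1 - q / 2) * (P * rho) `^ q)).
    rewrite [P in leRHS]PE selfsim -PE -/xi [leRHS]mulrCA ler_pM2l//.
    by rewrite lerBlDl; exact: powR_dominates.
  apply: ler_pM => //; first exact: powR_ge0.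
  by apply: ge0_ler_powR; rewrite ?nnegrE -?mulrA//; lra.
clear selfsim; have ts : th / s <= 1 by rewrite ler_pdivrMr// mul1r.
have ts0 : 0 <= th / s by rewrite divr_ge0// ltW.
have -> : 5 * (p / 2) * th * (P / s ^+ 2) * rho ^+ 2 =
    P * (5 * ((p / 2) * (th / s) * xi)).
  by rewrite /xi; field; rewrite gt_eqF.
have -> : p / 2 * th ^+ 2 * (P / s ^+ 2) = P * (p / 2 * (th / s) ^+ 2).
  by field; rewrite gt_eqF.
have t1 : (p / 2) * (th / s) * xi <= xi.
  by rewrite ler_piMl// mulr_ile1//; lra.
have t2 : p / 2 * (th / s) ^+ 2 <= p / 2.
  by rewrite ler_piMr ?expr_le1//; lra.
have : 4 / 5 * g <= P * g by rewrite ler_pM2r.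
have : P * (10 * D) <= P * (g / 8) by rewrite ler_pM2l//; lra.
have : P * (5 * (p / 2 * (th / s) * xi)) <= P * (5 * xi).
  by rewrite ler_pM2l//; lra.
have : P * (p / 2 * (th / s) ^+ 2) <= P * (p / 2) by rewrite ler_pM2l.
have : P * (8 * g) <= P * (1 - p / 2) by rewrite ler_pM2l//; lra.
clear -grad EK g0; lra.
Qed.

(** Passage from the dimensionless inequality to the original variables; the
    shape of the right-hand side is that of the derivatives of the barrier. *)
Lemma descent_rescaling p (di om r h lam eta th P s rho W d : R) :
    0 < om -> 0 < r -> 0 < h -> 0 < s ->
  (- (5 * (p / 2) * th * (P / s ^+ 2) * rho ^+ 2)
    + (P - p / 2 * th ^+ 2 * (P / s ^+ 2)) / 8
    - 10 * P * (d * h / r ^+ 2) + di * lam * W - eta * h / om) * (om / h) =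
  (0 * P + 5 * om / r ^+ 2 *
      (- (p / 4) * (P / s ^+ 2) * (0 + (h^-1 * th + th / h)))) *
      (rho ^+ 2 * r ^+ 2)
    + (0 + (0 * (th * P) + om / 8 * (h^-1 * P +
        th * (- (p / 4) * (P / s ^+ 2) * (0 + (h^-1 * th + th / h))))))
    - 2 * (5 * om / r ^+ 2 * P) * d + (di * (lam * om / h * W) - eta).
Proof.
move=> om0 r0 h0 s0; field.
by rewrite !gt_eqF.
Qed.

End PowerInequalities.

(** * Spreading of low values *)

Section Spreading.
Context {R : realType} {N : nat}.
Implicit Types (v : 'rV[R]_N * R -> R) (y x : 'rV[R]_N).

Lemma near_bottom_le v T y m (e t : R) :
    {within closed_strip 0 T, continuous v} -> 0 <= t <= T ->
    v (y, t) <= m -> 0 < e ->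
  exists2 k, 0 < k & forall x, sqnorm (x - y) < k ^+ 2 -> v (x, t) <= m + e.
Proof.
move=> cv tT vm e0.
have [[U V] /= [Uy Vt] UV] := within_continuous_near cv tT e0 (w := (y, t)).
have /nbhs_ballP[k /= k0 kU] := Uy; exists k => // x xyk.
have Ux : U x.
  apply: kU; rewrite -ball_normE /ball_/= distrC.
  apply: (le_lt_trans (norm_le_frobenius _)).
  by rewrite -(@ltr_pXn2r _ 2)// ?nnegrE ?frobenius_ge0 ?ltW// sqr_frobenius.
have := UV (x, t) (conj Ux (nbhs_singleton Vt)) tT.
by rewrite distrC => /ltr_normlW; lra.
Qed.

(** The barrier m + om / 16 + om (5 P rho^2 + th P / 8), with P = Z^(-p/4) and
    Z = kap^4 + th^2, starts above v because kap may be chosen after the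
    modulus of continuity of v at (y, t1): at the bottom it is steep enough to
    exceed m + om wherever v has left m + om / 16.  No quantity in the
    conclusion depends on kap.  The coefficient 5 makes the barrier exceed
    m + om on the lateral boundary, and leaves it below m + 3/4 om in the inner
    ball after half of the duration. *)
Lemma low_value_spreads v T K delta eta p q g lam y (m om r h t1 : R) :
    paraboloid_subsolution T K (fun s => delta^-1 * s `^ q - eta) v ->
    {within closed_strip 0 T, continuous v} ->
    1 < p -> p < 2 -> 2 < q -> p * q = p + q ->
    0 < g -> g <= (1 - p / 2) / 8 ->
    5 * (g / 10) `^ (1 - q / 2) <= delta^-1 * lam ->
    0 < om -> 0 < r -> 0 < h -> (om / r) `^ q * h = lam * om ->
    K * h <= g / 80 * r ^+ 2 -> eta * h <= g / 16 * om ->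
    0 <= t1 -> t1 + h <= T -> v (y, t1) <= m ->
    (forall x t, t1 <= t <= t1 + h -> sqnorm (x - y) <= r ^+ 2 / 4 ->
      v (x, t) <= m + om) ->
  forall x t, t1 + h / 2 <= t <= t1 + h ->
    sqnorm (x - y) <= 10 / 256 * r ^+ 2 ->
    v (x, t) <= m + 3 / 4 * om.
Proof.
move=> subv cv p1 p2 q2 pqM g0 gp gL om0 r0 h0 hlam hK heta t1_ge0 t1hT vm vle.
have t1T : 0 <= t1 <= T by rewrite t1_ge0; clear -h0 t1hT; lra.
have e0 : 0 < om / 16 by rewrite divr_gt0.
have [k k0 near_m] := near_bottom_le cv t1T vm e0.
have r20 : 0 < r ^+ 2 by rewrite exprn_gt0.
have c0 : 0 < 5 * om / r ^+ 2 by rewrite divr_gt0// mulr_gt0.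
(* At the bottom P = kap^(-p) >= kap^-1, which is at least r^2 / k^2. *)
pose kap := Num.min (1 / 2) (k ^+ 2 / r ^+ 2).
have kap0 : 0 < kap by rewrite lt_min !divr_gt0// exprn_gt0.
have kap2 : kap <= 1 / 2 by rewrite ge_min lexx.
have kapk : kap <= k ^+ 2 / r ^+ 2 by rewrite ge_min lexx orbT.
pose th t := h^-1 * (t - t1).
pose Z t := kap ^+ 4 + th t * th t.
have kap4 : 0 < kap ^+ 4 by rewrite exprn_gt0.
have Z0 t : 0 < Z t by rewrite ltr_pwDl// -expr2 sqr_ge0.
pose P t := Z t `^ (- (p / 4)).
have P0 t : 0 < P t by exact: powR_gt0.
have C1th : C1 th (fun=> h^-1) := C1_affine h^-1 t1.
have C1Z := C1D (C1_cst (kap ^+ 4)) (C1M C1th C1th).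
have C1P := C1_powR (- (p / 4)) Z0 C1Z.
have C1A := C1M (C1_cst (5 * om / r ^+ 2)) C1P.
have C1B := C1D (C1_cst (m + om / 16)) (C1M (C1_cst (om / 8)) (C1M C1th C1P)).
have th_ge0 t : t1 <= t -> 0 <= th t.
  by move=> t1t; rewrite mulr_ge0 ?invr_ge0 ?subr_ge0// ltW.
have th_le1 t : t <= t1 + h -> th t <= 1.
  by move=> tt1h; rewrite /th ler_pdivrMl//; clear -tt1h; lra.
have kap4_le : kap ^+ 4 <= 1 / 16.
  rewrite (_ : 1 / 16 = (1 / 2) ^+ 4); last by field.
  by rewrite ler_pXn2r// nnegrE ltW.
have Z54 t : t1 <= t <= t1 + h -> Z t <= 5 / 4.
  move=> /andP[/th_ge0 ge0 /th_le1 le1].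
  have : th t * th t <= 1 by rewrite mulr_ile1.
  by rewrite /Z; clear -kap4_le; lra.
have sqrtZ0 t : 0 < Num.sqrt (Z t) by rewrite sqrtr_gt0.
have PsqrtZ t : P t = Num.sqrt (Z t) `^ (- (p / 2)).
  rewrite /P -{1}(sqr_sqrtr (ltW (Z0 t))) -powR_mulrn ?sqrtr_ge0// -powRrM.
  by congr (_ `^ _); field.
have P45 t : t1 <= t <= t1 + h -> 4 / 5 <= P t.
  move=> t1t; rewrite PsqrtZ; apply: powR_near1_ge => //.
  by rewrite sqr_sqrtr; [exact: Z54|exact: ltW].
suff main x t : t1 <= t <= t1 + h -> sqnorm (x - y) <= r ^+ 2 / 4 ->
    v (x, t) <= 5 * om / r ^+ 2 * P t * sqnorm (x - y) +
      (m + om / 16 + om / 8 * (th t * P t)).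
  move=> x t /andP[ht th1] xy.
  have t1t : t1 <= t <= t1 + h by rewrite th1 andbT; clear -ht h0; lra.
  have xy4 : sqnorm (x - y) <= r ^+ 2 / 4 by clear -xy r20; lra.
  apply: (le_trans (main x t t1t xy4)).
  have P2 : P t <= 2.
    rewrite PsqrtZ; apply: powR_half_le => //.
    rewrite -(@ler_pXn2r _ 2)// ?nnegrE ?sqrtr_ge0// sqr_sqrtr ?(ltW (Z0 t))//.
    have th2 : 1 / 2 <= th t.
      by rewrite /th ler_pdivlMl//; clear -ht; lra.
    have : 1 / 2 * (1 / 2) <= th t * th t by apply: ler_pM.
    by rewrite /Z; have := ltW kap4; clear; lra.
  have Xr : sqnorm (x - y) / r ^+ 2 <= 10 / 256 by rewrite ler_pdivrMr.
  have Xr0 : 0 <= sqnorm (x - y) / r ^+ 2 by rewrite divr_ge0 ?sqnorm_ge0// ltW.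
  have PX : P t * (sqnorm (x - y) / r ^+ 2) <= 2 * (10 / 256).
    by apply: ler_pM => //; exact: ltW.
  have thP : th t * P t <= 1 * 2.
    apply: ler_pM => //; [|exact: ltW|exact: th_le1].
    by apply: th_ge0; clear -ht h0; lra.
  have -> : 5 * om / r ^+ 2 * P t * sqnorm (x - y) =
      5 * (om * (P t * (sqnorm (x - y) / r ^+ 2))) by field; rewrite gt_eqF.
  have : om * (P t * (sqnorm (x - y) / r ^+ 2)) <= om * (2 * (10 / 256)).
    by rewrite ler_pM2l.
  have : om * (th t * P t) <= om * (1 * 2) by rewrite ler_pM2l.
  by clear -om0; lra.
move=> t1t xy4; apply: (comparison subv cv C1A C1B) t1t xy4 => //.
- by clear -h0; lra.
- move=> {}x {}t d t1t xy /andP[d0 dK] /=.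
  have t1t' : t1 <= t <= t1 + h by case/andP: t1t => ? ?; rewrite !ltW.
  pose s := Num.sqrt (Z t); pose rho := frobenius (x - y) / r.
  have s0 : 0 < s by exact: sqrtZ0.
  have s2 : s ^+ 2 = Z t by rewrite sqr_sqrtr// ltW.
  have th0 : 0 <= th t by case/andP: t1t' => + _; exact: th_ge0.
  have ths : th t <= s.
    rewrite -(@ler_pXn2r _ 2) ?nnegrE ?(ltW s0)// s2 /Z expr2.
    by rewrite lerDr ltW.
  have rho0 : 0 <= rho by rewrite divr_ge0 ?frobenius_ge0// ltW.
  have DK : d * h / r ^+ 2 <= g / 80.
    rewrite ler_pdivrMr//; apply: le_trans hK.
    by rewrite ler_pM2r.
  have EK : eta * h / om <= g / 16 by rewrite ler_pdivrMr.
  have thsI : 0 <= th t <= s by rewrite th0.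
  have s54 : s ^+ 2 <= 5 / 4 by rewrite s2; exact: Z54.
  have := descent_inequality p1 p2 q2 pqM g0 gp gL s0 thsI s54 rho0 DK EK
    (PsqrtZ t).
  have ZP : Z t `^ (- (p / 4) - 1) = P t / s ^+ 2.
    rewrite powRD; last by apply/implyP => _; rewrite gt_eqF.
    by rewrite powR_inv1 ?ltW// s2.
  rewrite ZP -/(P t); set Pt := P t; have Pt0 : 0 < Pt by exact: P0.
  have slope : 2 * `|5 * om / r ^+ 2 * Pt| * frobenius (x - y) =
      om / r * (10 * Pt * rho).
    rewrite ger0_norm; last by rewrite mulr_ge0// ltW.
    by rewrite /rho; field; rewrite gt_eqF.
  have omr0 : 0 <= om / r by rewrite divr_ge0 ?ltW.
  have slope0 : 0 <= 10 * Pt * rho.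
    by apply: mulr_ge0 => //; apply: mulr_ge0 => //; exact: ltW.
  rewrite slope (powRM _ omr0 slope0).
  set W := (10 * Pt * rho) `^ q; have -> : (om / r) `^ q = lam * om / h.
    by rewrite -hlam mulfK// gt_eqF.
  have -> : sqnorm (x - y) = rho ^+ 2 * r ^+ 2.
    by rewrite -sqr_frobenius -exprMn divfK// gt_eqF.
  move: delta^-1 => di norm_gt0; have : 0 < om / h by rewrite divr_gt0.
  by move=> /(mulr_gt0 norm_gt0); rewrite descent_rescaling.
- move=> {}x xy; rewrite /paraboloid/=.
  have th0 : th t1 = 0 by rewrite /th subrr mulr0.
  have Pkap : P t1 = kap `^ (- p).
    rewrite /P /Z th0 mulr0 addr0 -powR_mulrn ?ltW// -powRrM.
    by congr (_ `^ _); field.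
  have Pkap1 : kap^-1 <= P t1.
    rewrite Pkap -powR_inv1 ?(ltW kap0)//; apply: ger_powR; last first.
      by clear -p1; lra.
    by rewrite kap0; clear -kap2; lra.
  rewrite th0 mul0r mulr0 addr0.
  have [xk|xk] := ltP (sqnorm (x - y)) (k ^+ 2).
    apply: (le_trans (near_m _ xk)); rewrite lerDr.
    apply: mulr_ge0 _ (sqnorm_ge0 _).
    by apply: mulr_ge0; [exact: ltW c0|exact: ltW (P0 t1)].
  have : v (x, t1) <= m + om by apply: vle => //; clear -h0; lra.
  have -> : 5 * om / r ^+ 2 * P t1 * sqnorm (x - y) =
      5 * (om * (P t1 * (sqnorm (x - y) / r ^+ 2))) by field; rewrite gt_eqF.
  have : kap^-1 * kap <= P t1 * (sqnorm (x - y) / r ^+ 2).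
    apply: ler_pM => //; rewrite ?invr_ge0 ?(ltW kap0)//.
    by apply: (le_trans kapk); rewrite ler_pM2r ?invr_gt0.
  by rewrite mulVf ?gt_eqF// -(ler_pM2l om0); clear -om0; lra.
- move=> {}x {}t t1t xy; rewrite /paraboloid/= -/(P t).
  have : v (x, t) <= m + om by apply: vle => //; clear -xy; lra.
  have -> : 5 * om / r ^+ 2 * P t * sqnorm (x - y) = 5 / 4 * (om * P t).
    by rewrite xy; field; rewrite gt_eqF.
  have : om * (4 / 5) <= om * P t by rewrite ler_pM2l//; exact: P45.
  have : 0 <= om * (th t * P t).
    apply: mulr_ge0 (ltW om0) _; apply: mulr_ge0 _ (ltW (P0 t)).
    by apply: th_ge0; case/andP: t1t.
  by clear -om0; lra.
Qed.

End Spreading.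
(** * Decay of the oscillation *)

Section Decay.
Context {R : realType} {N : nat}.
Implicit Types (u v : 'rV[R]_N * R -> R) (x y : 'rV[R]_N).

Lemma high_value_gradient_le (om r h lam delta q gm rho : R) :
    0 < delta -> 2 < q -> 0 < om -> 0 < r -> 0 < h ->
    (om / r) `^ q * h = lam * om ->
    0 < gm -> gm <= 1 -> delta * lam * 32 `^ q * gm <= 1 / 8 ->
    0 <= rho <= 1 / 8 ->
  delta * (om / r * (256 * gm * rho)) `^ q <= om / h * (gm / 8).
Proof.
move=> delta0 q2 om0 r0 h0 hlam gm0 gm1 gmL /andP[rho0 rho8].
have q0 : 0 <= q by clear -q2; lra.
have omr0 : 0 <= om / r by rewrite divr_ge0 ?ltW.
have gmr0 : 0 <= 256 * gm * rho by rewrite mulr_ge0// mulr_ge0// ltW.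
rewrite (powRM _ omr0 gmr0) (_ : (om / r) `^ q = lam * om / h); last first.
  by rewrite -hlam mulfK// gt_eqF.
have lam0 : 0 <= lam.
  by rewrite -(pmulr_lge0 _ om0) -hlam mulr_ge0 ?powR_ge0// ltW.
have gm32 : (256 * gm * rho) `^ q <= 32 `^ q * (gm * gm).
  apply: (@le_trans _ _ ((32 * gm) `^ q)).
    apply: ge0_ler_powR; rewrite ?nnegrE//; first by rewrite mulr_ge0// ltW.
    have : gm * rho <= gm * (1 / 8) by rewrite ler_pM2l.
    by clear; lra.
  rewrite powRM ?(ltW gm0)// ler_pM2l ?powR_gt0//.
  rewrite -expr2 -powR_mulrn ?(ltW gm0)//; apply: ger_powR.
    by rewrite gm0.
  exact: ltW.
have -> : delta * (lam * om / h * (256 * gm * rho) `^ q) =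
    om / h * (delta * lam * (256 * gm * rho) `^ q) by ring.
rewrite ler_pM2l ?divr_gt0//.
apply: (@le_trans _ _ (delta * lam * (32 `^ q * (gm * gm)))).
  by apply: ler_pM => //; [exact: mulr_ge0 (ltW _) _|exact: powR_ge0].
have -> : delta * lam * (32 `^ q * (gm * gm)) =
   gm * (delta * lam * 32 `^ q * gm) by ring.
have : gm * (delta * lam * 32 `^ q * gm) <= gm * (1 / 8) by rewrite ler_pM2l.
by clear; lra.
Qed.

(** The barrier m + om (1 - 2 gm + 128 gm rho^2 + gm th / 2) has a slope of
    order gm, and gm^q is much smaller than gm: for gm small, its slow growth in
    time dominates the Hamiltonian.  It equals m + om at time t1 on the sphere
    rho = 1/8. *)
Lemma high_values_persist v T K delta eta q lam gm y (m om r h t1 : R) :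
    paraboloid_subsolution T K (fun s => - (delta * s `^ q) - eta) v ->
    {within closed_strip 0 T, continuous v} ->
    0 < delta -> 2 < q -> 0 < om -> 0 < r -> 0 < h ->
    (om / r) `^ q * h = lam * om ->
    0 < gm -> gm <= 1 / 2 -> delta * lam * 32 `^ q * gm <= 1 / 8 ->
    K * h <= r ^+ 2 / 2048 -> eta * h <= gm / 16 * om ->
    0 <= t1 -> t1 + h <= T ->
    (forall x, sqnorm (x - y) <= r ^+ 2 / 64 -> v (x, t1) <= m) ->
    (forall x t, t1 <= t <= t1 + h -> sqnorm (x - y) <= r ^+ 2 / 64 ->
      v (x, t) <= m + om) ->
  forall x t, t1 <= t <= t1 + h -> sqnorm (x - y) <= r ^+ 2 / 256 ->
    v (x, t) <= m + (1 - gm) * om.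
Proof.
move=> subv cv delta0 q2 om0 r0 h0 hlam gm0 gm2 gmL hK heta t1_ge0 t1hT vm vle.
have r20 : 0 < r ^+ 2 by rewrite exprn_gt0.
have omgm0 : 0 < om * gm by rewrite mulr_gt0.
have c0 : 0 < 128 * (om * gm) / r ^+ 2 by rewrite divr_gt0// mulr_gt0.
have C1A := C1_cst (128 * (om * gm) / r ^+ 2).
have C1B := C1D (C1_cst (m + (1 - 2 * gm) * om))
  (C1M (C1_cst (om * gm / 2)) (C1_affine h^-1 t1)).
move=> x t t1t xy256.
have xy64 : sqnorm (x - y) <= r ^+ 2 / 64 by clear -xy256 r20; lra.
apply: (le_trans (comparison subv cv C1A C1B _ _ _ _ _ _ t1t xy64)) => //.
- by clear -h0; lra.
- move=> {xy256 xy64 t1t}x {}t d t1t xy /andP[d0 dK] /=.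
  pose rho := frobenius (x - y) / r.
  have rho0 : 0 <= rho by rewrite divr_ge0 ?frobenius_ge0// ltW.
  have rho8 : rho <= 1 / 8.
    rewrite ler_pdivrMr// -(@ler_pXn2r _ 2) ?nnegrE ?frobenius_ge0//.
      by rewrite sqr_frobenius exprMn; clear -xy; lra.
    by rewrite mulr_ge0// ltW.
  have slope : 2 * `|128 * (om * gm) / r ^+ 2| * frobenius (x - y) =
      om / r * (256 * gm * rho).
    rewrite ger0_norm; last exact: ltW.
    by rewrite /rho; field; rewrite gt_eqF.
  have rhoI : 0 <= rho <= 1 / 8 by rewrite rho0.
  have gm1 : gm <= 1 by clear -gm2; lra.
  have := high_value_gradient_le delta0 q2 om0 r0 h0 hlam gm0 gm1 gmL rhoI.
  rewrite slope; set W := delta * _; set k := om / h => WK.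
  have k0 : 0 < k by rewrite divr_gt0.
  have etaK : eta <= k * (gm / 16).
    by rewrite /k mulrAC ler_pdivlMr// [om * _]mulrC.
  have dE : 2 * (128 * (om * gm) / r ^+ 2) * d <= k * (gm / 8).
    have -> : 2 * (128 * (om * gm) / r ^+ 2) * d =
        k * (gm * (256 * (d * h / r ^+ 2))).
      by rewrite /k; field; rewrite !gt_eqF.
    rewrite ler_pM2l// ler_pM2l//.
    have : d * h / r ^+ 2 <= 1 / 2048.
      rewrite ler_pdivrMr//.
      have : d * h <= K * h by rewrite ler_pM2r.
      by clear -hK; lra.
    by clear; lra.
  have -> : om * gm / 2 * h^-1 = k * (gm / 2) by rewrite /k; ring.
  have : 0 < k * gm by rewrite mulr_gt0.
  by clear -WK etaK dE; lra.
- move=> {xy256 xy64 t1t}x xy; rewrite /paraboloid/= subrr !mulr0 addr0.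
  apply: (le_trans (vm _ xy)).
  have : 0 <= 128 * (om * gm) / r ^+ 2 * sqnorm (x - y).
    by rewrite mulr_ge0 ?sqnorm_ge0// ltW.
  have : 0 <= (1 - 2 * gm) * om.
    by rewrite mulr_ge0 ?(ltW om0)//; clear -gm2; lra.
  by clear; lra.
- move=> {xy256 xy64 t1t t}x t t1t xy; rewrite /paraboloid/=.
  apply: (le_trans (vle _ _ t1t _)); first by rewrite xy.
  have -> : 128 * (om * gm) / r ^+ 2 * sqnorm (x - y) = 2 * (om * gm).
    by rewrite xy; field; rewrite gt_eqF.
  have : 0 <= om * gm / 2 * (h^-1 * (t - t1)).
    apply: mulr_ge0; first by rewrite divr_ge0// ltW.
    by case/andP: t1t => t1t _; rewrite mulr_ge0 ?invr_ge0 ?subr_ge0// ltW.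
  by clear; lra.
have Xr : sqnorm (x - y) / r ^+ 2 <= 1 / 256.
  by rewrite ler_pdivrMr//; clear -xy256; lra.
have th1 : h^-1 * (t - t1) <= 1.
  by rewrite ler_pdivrMl//; case/andP: t1t => _; clear; lra.
rewrite /paraboloid/=.
have -> : 128 * (om * gm) / r ^+ 2 * sqnorm (x - y) =
    128 * (om * gm * (sqnorm (x - y) / r ^+ 2)) by field; rewrite gt_eqF.
have : om * gm * (sqnorm (x - y) / r ^+ 2) <= om * gm * (1 / 256).
  by rewrite ler_pM2l.
have : om * gm * (h^-1 * (t - t1)) <= om * gm * 1 by rewrite ler_pM2l.
by clear; lra.
Qed.

(** The alternative on the bottom of the cylinder: some value below the middle m
    near the centre lowers the upper bound by om / 4, otherwise the lower bound
    rises by gm om. *)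
Lemma oscillation_decay u T K delta etam etap p q g lam gm x0
    (m om r h t2 : R) :
    paraboloid_subsolution T K (fun s => delta^-1 * s `^ q - etam) u ->
    paraboloid_subsolution T K (fun s => - (delta * s `^ q) - etap)
      (fun w => - u w) ->
    {within closed_strip 0 T, continuous u} ->
    0 < delta -> 1 < p -> p < 2 -> 2 < q -> p * q = p + q ->
    0 < g -> g <= (1 - p / 2) / 8 ->
    5 * (g / 10) `^ (1 - q / 2) <= delta^-1 * lam ->
    0 < gm -> gm <= 1 / 4 -> delta * lam * 32 `^ q * gm <= 1 / 8 ->
    0 < om -> 0 < r -> 0 < h -> (om / r) `^ q * h = lam * om ->
    K * h <= g / 80 * r ^+ 2 -> K * h <= r ^+ 2 / 2048 ->
    etam * h <= g / 16 * om -> etap * h <= gm / 16 * om ->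
    h <= t2 -> t2 <= T ->
    (forall x t, t2 - h <= t <= t2 -> sqnorm (x - x0) <= r ^+ 2 ->
      `|u (x, t) - m| <= om) ->
  exists m', forall x t, t2 - h / 2 <= t <= t2 ->
    sqnorm (x - x0) <= (r / 16) ^+ 2 -> `|u (x, t) - m'| <= (1 - gm / 2) * om.
Proof.
move=> subu superu cu delta0 p1 p2 q2 pqM g0 gp gL gm0 gm4 gmL om0 r0 h0 hlam.
move=> hKg hK etamh etaph ht2 t2T um.
have r20 : 0 < r ^+ 2 by rewrite exprn_gt0.
have omgm0 : 0 < om * gm by rewrite mulr_gt0.
have omgm4 : om * gm <= om * (1 / 4) by rewrite ler_pM2l.
have t1_ge0 : 0 <= t2 - h by clear -ht2; lra.
have t1hE : t2 - h + h = t2 by rewrite subrK.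
have r16 : (r / 16) ^+ 2 = r ^+ 2 / 256 by field.
(* The first barrier is centred at y, the second one at x0. *)
have [[y [yx0 uy]]|high] :=
  pselect (exists y, sqnorm (y - x0) <= r ^+ 2 / 64 /\ u (y, t2 - h) <= m).
  have t1hT : t2 - h + h <= T by rewrite t1hE.
  have ule x t : t2 - h <= t <= t2 - h + h -> sqnorm (x - y) <= r ^+ 2 / 4 ->
      u (x, t) <= m + om.
    rewrite t1hE => t1t xy.
    have := sqnormD_le (x - y) (y - x0); rewrite addrA subrK => xx0.
    have /ler_normlW : `|u (x, t) - m| <= om.
      by apply: um => //; clear -xx0 xy yx0 r20; lra.
    by clear; lra.
  have low := low_value_spreads subu cu p1 p2 q2 pqM g0 gp gL om0 r0 h0 hlam
    hKg etamh t1_ge0 t1hT uy ule.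
  exists (m - gm / 2 * om) => x t t2t; rewrite r16 => xx0.
  have {low} : u (x, t) <= m + 3 / 4 * om.
    apply: low; first by case/andP: t2t; clear; lra.
    have := sqnormD_le (x - x0) (x0 - y); rewrite addrA subrK.
    by rewrite -(sqnormN (x0 - y)) opprB; clear -xx0 yx0; lra.
  have /ler_normlP[+ _] : `|u (x, t) - m| <= om.
    apply: um; first by case/andP: t2t; clear -h0; lra.
    by clear -xx0 r20; lra.
  by rewrite ler_norml; clear -omgm4 omgm0; lra.
have t1hT : t2 - h + h <= T by rewrite t1hE.
have cNu : {within closed_strip 0 T, continuous (fun w => - u w)}.
  by move=> w; apply: cvgN; exact: cu.
have gm2 : gm <= 1 / 2 by clear -gm4; lra.
have vm x : sqnorm (x - x0) <= r ^+ 2 / 64 -> - u (x, t2 - h) <= - m.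
  move=> xx0; rewrite lerN2 leNgt; apply/negP => ux; apply: high.
  by exists x; split=> //; exact: ltW.
have vle x t : t2 - h <= t <= t2 - h + h -> sqnorm (x - x0) <= r ^+ 2 / 64 ->
    - u (x, t) <= - m + om.
  rewrite t1hE => t1t xx0.
  have /ler_normlP[+ _] : `|u (x, t) - m| <= om.
    by apply: um => //; clear -xx0 r20; lra.
  by clear; lra.
have persist := high_values_persist superu cNu delta0 q2 om0 r0 h0 hlam gm0 gm2
  gmL hK etaph t1_ge0 t1hT vm vle.
exists (m + gm / 2 * om) => x t t2t; rewrite r16 => xx0.
have {persist} : - u (x, t) <= - m + (1 - gm) * om.
  by apply: persist => //; rewrite t1hE; case/andP: t2t; clear -h0; lra.
have /ler_normlP[_] : `|u (x, t) - m| <= om.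
  apply: um; first by case/andP: t2t; clear -h0; lra.
  by clear -xx0 r20; lra.
by rewrite ler_norml; clear -omgm4 omgm0; lra.
Qed.

End Decay.
(** * Iteration *)

Section Iteration.
Context {R : realType} {N : nat}.
Implicit Types (u : 'rV[R]_N * R -> R) (x : 'rV[R]_N).

Lemma exists_expr_lt (b e : R) : 0 <= b < 1 -> 0 < e -> exists n, b ^+ n < e.
Proof.
move=> /andP[b0 b1] e0; have cvgb : b ^+ n @[n --> \oo] --> (0 : R).
  by apply: cvg_expr; rewrite ger0_norm.
have near_lt : \forall n \near \oo, b ^+ n < e by exact: (cvgr_lt 0 cvgb).
by have /filter_ex := near_lt.
Qed.

(** The two points are compared at the first scale n that does not contain them
    both: the previous scale bounds D, and the failure at scale n bounds
    gamma^n by a power of one of the two distances. *)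
Lemma geometric_decay_modulus (mu nu gamma alpha beta r h B d s D : R) :
    0 < mu < 1 -> 0 < nu < 1 -> 0 < alpha -> 0 < beta ->
    mu `^ alpha = gamma -> nu `^ beta = gamma ->
    0 < r -> 0 < h -> 0 < B -> 0 <= d -> 0 <= s -> 0 < d \/ 0 < s ->
    D <= B ->
    (forall n, d <= r * mu ^+ n -> s <= h * nu ^+ n -> D <= B * gamma ^+ n) ->
  D <= B / gamma * (r `^ (- alpha) + h `^ (- beta)) *
    (d `^ alpha + s `^ beta).
Proof.
move=> /andP[mu0 mu1] /andP[nu0 nu1] a0 b0 gmu gnu r0 h0 B0 d0 s0 ds DB Dn.
have gam0 : 0 < gamma by rewrite -gmu powR_gt0.
have gam1 : gamma <= 1.
  have <- : 1 `^ alpha = 1 :> R by rewrite powR1.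
  by rewrite -gmu; apply: ge0_ler_powR; rewrite ?nnegrE ltW.
have fails : exists n, ~~ ((d <= r * mu ^+ n) && (s <= h * nu ^+ n)).
  case: ds => [d_gt0|s_gt0].
    have [||n nd] := @exists_expr_lt mu (d / r); rewrite ?(ltW mu0) ?divr_gt0//.
    by exists n; rewrite negb_and -ltNge mulrC -ltr_pdivlMr// nd.
  have [||n ns] := @exists_expr_lt nu (s / h); rewrite ?(ltW nu0) ?divr_gt0//.
  by exists n; rewrite negb_and orbC -ltNge mulrC -ltr_pdivlMr// ns.
case: (ex_minnP fails) => n nfail nmin.
have Dgam : D <= B / gamma * gamma ^+ n.
  case: n nfail nmin => [|n] _ nmin.
    by rewrite expr0 mulr1 (le_trans DB)// ler_pdivlMr// ler_piMr// ltW.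
  rewrite exprS mulrA divfK ?gt_eqF//.
  have [/andP[dn sn]|/nmin] := boolP ((d <= r * mu ^+ n) && (s <= h * nu ^+ n)).
    exact: Dn.
  by rewrite ltnn.
apply: (le_trans Dgam); rewrite -[leRHS]mulrA ler_pM2l ?divr_gt0//.
have scale (b c z k e : R) : 0 < b -> 0 < k -> 0 < e -> b `^ e = gamma ->
    k * b ^+ n <= z -> gamma ^+ n <= k `^ (- e) * z `^ e.
  move=> bp kp ep bE kz.
  rewrite powRN mulrC ler_pdivlMr ?powR_gt0//.
  have -> : gamma ^+ n * k `^ e = (k * b ^+ n) `^ e.
    rewrite powRM ?exprn_ge0 ?(ltW kp) ?(ltW bp)// mulrC; congr (_ * _).
    by rewrite -bE -powR_mulrn ?powR_ge0// powRAC powR_mulrn// ltW.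
  have z0 : 0 <= z.
    by apply: le_trans kz; rewrite mulr_ge0 ?exprn_ge0// ltW.
  have kb0 : 0 <= k * b ^+ n by rewrite mulr_ge0 ?exprn_ge0// ltW.
  by apply: ge0_ler_powR => //; exact: ltW.
have nonneg (b e : R) : 0 <= b `^ e by exact: powR_ge0.
rewrite mulrDr !mulrDl.
have r1 := nonneg r (- alpha); have h1 := nonneg h (- beta).
have d1 := nonneg d alpha; have s1 := nonneg s beta.
have m1 := mulr_ge0 r1 d1; have m2 := mulr_ge0 r1 s1.
have m3 := mulr_ge0 h1 d1; have m4 := mulr_ge0 h1 s1.
move: nfail; rewrite negb_and -!ltNge => /orP[rd|hs].
  have := scale mu 0 d r alpha mu0 r0 a0 gmu (ltW rd).
  by clear -m2 m3 m4; lra.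
have := scale nu 0 s h beta nu0 h0 b0 gnu (ltW hs).
by clear -m1 m2 m3; lra.
Qed.

(** The hypotheses of the decay are inherited by the smaller cylinder: the
    balance is preserved by the choice of nu, the diffusion condition because
    nu <= 16^-2, and the conditions on etam and etap because nu <= gamma. *)
Lemma oscillation_iterate u T K delta etam etap p q g lam gm gamma nu x0 t2 :
    paraboloid_subsolution T K (fun s => delta^-1 * s `^ q - etam) u ->
    paraboloid_subsolution T K (fun s => - (delta * s `^ q) - etap)
      (fun w => - u w) ->
    {within closed_strip 0 T, continuous u} ->
    0 < delta -> 0 <= K -> 0 <= etam -> 0 <= etap ->
    1 < p -> p < 2 -> 2 < q -> p * q = p + q ->
    0 < g -> g <= (1 - p / 2) / 8 ->
    5 * (g / 10) `^ (1 - q / 2) <= delta^-1 * lam ->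
    0 < gm -> gm <= 1 / 4 -> delta * lam * 32 `^ q * gm <= 1 / 8 ->
    0 < gamma -> 1 - gm / 2 <= gamma -> 0 < nu -> nu <= 1 / 256 ->
    nu <= gamma -> (16 * gamma) `^ q * nu = gamma ->
    t2 <= T ->
  forall n (m om r h : R),
    0 < om -> 0 < r -> 0 < h -> (om / r) `^ q * h = lam * om ->
    K * h <= g / 80 * r ^+ 2 -> K * h <= r ^+ 2 / 2048 ->
    etam * h <= g / 16 * om -> etap * h <= gm / 16 * om ->
    h <= t2 ->
    (forall x t, t2 - h <= t <= t2 -> sqnorm (x - x0) <= r ^+ 2 ->
      `|u (x, t) - m| <= om) ->
  exists m', forall x t, t2 - h * nu ^+ n <= t <= t2 ->
    sqnorm (x - x0) <= (r * 16^-1 ^+ n) ^+ 2 ->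
    `|u (x, t) - m'| <= om * gamma ^+ n.
Proof.
move=> subu superu cu delta0 K0 etam0 etap0 p1 p2 q2 pqM g0 gp gL gm0 gm4 gmL.
move=> gamma0 gmgamma nu0 nu256 nugamma scale t2T.
elim=> [|n IHn] m om r h om0 r0 h0 hlam hKg hK etamh etaph ht2 um.
  by exists m => x t; rewrite !expr0 !mulr1; exact: um.
have [m' um'] := oscillation_decay subu superu cu delta0 p1 p2 q2 pqM g0 gp gL
  gm0 gm4 gmL om0 r0 h0 hlam hKg hK etamh etaph ht2 t2T um.
have r20 : 0 < r ^+ 2 by rewrite exprn_gt0.
have hnu : h * nu <= h / 256.
  by rewrite -[h / 256]/(h * _) ler_pM2l//; clear -nu256; lra.
have Khnu : K * (h * nu) <= K * h / 256.
  by rewrite -mulrA ler_wpM2l.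
have eta_step (eta c : R) : 0 <= eta -> eta * h <= c * om ->
    eta * (h * nu) <= c * (om * gamma).
  move=> eta0 etah; rewrite mulrA mulrA.
  apply: (@le_trans _ _ (eta * h * gamma)).
    by apply: ler_wpM2l => //; rewrite mulr_ge0// ltW.
  by rewrite ler_pM2r.
have r16 : (r * 16^-1) ^+ 2 = r ^+ 2 / 256 by field.
have [||||||||||m'' um''] := IHn m' (om * gamma) (r * 16^-1) (h * nu).
- by rewrite mulr_gt0.
- by rewrite mulr_gt0.
- by rewrite mulr_gt0.
- have -> : om * gamma / (r * 16^-1) = om / r * (16 * gamma).
    by field; rewrite gt_eqF.
  rewrite powRM ?divr_ge0 ?mulr_ge0 ?(ltW om0) ?(ltW r0) ?(ltW gamma0)//.
  have -> : (om / r) `^ q * (16 * gamma) `^ q * (h * nu) =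
      (om / r) `^ q * h * ((16 * gamma) `^ q * nu) by ring.
  by rewrite hlam scale mulrA.
- by rewrite r16; clear -Khnu hKg r20; lra.
- by rewrite r16; clear -Khnu hK r20; lra.
- exact: eta_step.
- exact: eta_step.
- by clear -hnu ht2 h0; lra.
- move=> x t /andP[t1t tt2] xx0.
  have : `|u (x, t) - m'| <= (1 - gm / 2) * om.
    apply: um' => //; rewrite tt2 andbT.
    by clear -t1t hnu h0; lra.
  by move/le_trans; apply; rewrite mulrC ler_pM2l.
exists m'' => x t; rewrite (exprS nu) (exprS gamma) (exprS 16^-1) !mulrA.
exact: um''.
Qed.

Lemma powR_ge1Dx (b e : R) : 0 < b -> 1 + e * ln b <= b `^ e.
Proof. by move=> b0; rewrite /powR gt_eqF// expR_ge1Dx. Qed.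

End Iteration.

Section InitialScale.
Context {R : realType}.

(** Along the balance, h is proportional to r^q, hence to r^2 times the positive
    power r^(q - 2), which is small for small r. *)
Lemma exists_initial_scale (q lam M c : R) : 2 < q -> 0 < lam -> 0 < M ->
  0 < c ->
  exists r h : R, [/\ 0 < r, 0 < h, (M / r) `^ q * h = lam * M,
    h <= c * r ^+ 2 & h <= c].
Proof.
move=> q2 lam0 M0 c0; have q20 : 0 < q - 2 by rewrite subr_gt0.
pose k := c * M `^ q / (lam * M).
have k0 : 0 < k by rewrite divr_gt0 ?mulr_gt0 ?powR_gt0.
pose r := Num.min 1 (k `^ (q - 2)^-1).
have r0 : 0 < r by rewrite lt_min ltr01 powR_gt0.
have r1 : r <= 1 by rewrite ge_min lexx.
have rk : r `^ (q - 2) <= k.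
  have -> : k = (k `^ (q - 2)^-1) `^ (q - 2).
    by rewrite -powRrM mulVf ?gt_eqF// powRr1// ltW.
  by apply: ge0_ler_powR; rewrite ?nnegrE ?powR_ge0 ?ge_min ?lexx ?orbT// ltW.
have Mr0 : 0 < (M / r) `^ q by rewrite powR_gt0// divr_gt0.
pose h := lam * M / (M / r) `^ q.
have hr : h <= c * r ^+ 2.
  rewrite /h ler_pdivrMr// powRM ?(ltW M0) ?invr_ge0 ?(ltW r0)//.
  have -> : r^-1 `^ q = (r `^ q)^-1.
    by rewrite -[r^-1]powR_inv1 ?(ltW r0)// -powRrM mulN1r powRN.
  have -> : r `^ q = r `^ (q - 2) * r ^+ 2.
    rewrite -powR_mulrn ?(ltW r0)// -powRD ?subrK//.
    by apply/implyP => _; rewrite gt_eqF.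
  have -> : c * r ^+ 2 * (M `^ q / (r `^ (q - 2) * r ^+ 2)) =
      c * M `^ q / r `^ (q - 2).
    by field; rewrite !gt_eqF ?powR_gt0.
  rewrite ler_pdivlMr ?powR_gt0// mulrC -ler_pdivlMr//.
  by rewrite mulr_gt0.
exists r, h; split=> //.
- by rewrite divr_gt0// mulr_gt0.
- by rewrite /h mulrC divfK// gt_eqF.
- by apply: (le_trans hr); rewrite ler_piMr ?(ltW c0)// exprn_ile1// ltW.
Qed.

End InitialScale.
Section HolderExponent.
Context {R : realType}.

(** With gamma = 16^-alpha and nu = 16^-kappa, the balance requires
    kappa = q - alpha (q - 1).  Then nu <= 16^-2 reads alpha (q - 1) <= q - 2,
    and 1 - gm / 2 <= gamma holds once alpha ln 16 <= gm / 2. *)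
Lemma exists_holder_exponent (p q gm : R) :
    1 < p -> p < 2 -> 2 < q -> p * q = p + q -> 0 < gm -> gm < 1 ->
  exists alpha gamma nu : R,
    [/\ 0 < alpha < 1, 0 < gamma & 1 - gm / 2 <= gamma] /\
    [/\ 0 < nu, nu <= 1 / 256, nu <= gamma & (16 * gamma) `^ q * nu = gamma] /\
    16^-1 `^ alpha = gamma /\
    nu `^ (alpha * (p - 1) / (p - alpha)) = gamma.
Proof.
move=> p1 p2 q2 pqM gm0 gm1.
have ln16 : 0 < ln (16 : R) by rewrite ln_gt0// ltr1n.
have q10 : 0 < q - 1 by clear -q2; lra.
pose alpha := Num.min ((q - 2) / (q - 1)) (gm / (2 * ln 16)).
have alpha0 : 0 < alpha.
  by rewrite lt_min !divr_gt0 ?mulr_gt0 ?(subr_gt0 2).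
have alphaq : alpha * (q - 1) <= q - 2.
  by rewrite -ler_pdivlMr// ge_min lexx.
have alphagm : alpha * ln 16 <= gm / 2.
  rewrite -ler_pdivlMr// ge_min; apply/orP; right.
  by rewrite invfM mulrA.
have alpha1 : alpha < 1.
  by rewrite -(ltr_pM2r q10) mul1r; clear -alphaq; lra.
pose mu : R := 16^-1.
have mu0 : 0 < mu by rewrite invr_gt0.
have mu1 : mu <= 1 by rewrite invf_le1// ler1n.
have mumono (a b : R) : a <= b -> mu `^ b <= mu `^ a.
  by move=> ab; apply: ger_powR => //; rewrite mu0.
have muD (a b : R) : mu `^ a * mu `^ b = mu `^ (a + b).
  by rewrite powRD//; apply/implyP => _; rewrite gt_eqF.
pose kappa := q - alpha * (q - 1).
have kappa2 : 2 <= kappa by rewrite /kappa; clear -alphaq; lra.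
exists alpha, (mu `^ alpha), (mu `^ kappa); split; [|split; [|split]] => //.
- split; [by rewrite alpha0|exact: powR_gt0|].
  apply: le_trans (powR_ge1Dx alpha mu0).
  by rewrite lnV ?posrE//; clear -alphagm; lra.
- split; first exact: powR_gt0.
  + have -> : 1 / 256 = mu `^ 2%:R :> R.
      by rewrite powR_mulrn ?(ltW mu0)// /mu; field.
    exact: mumono.
  + by apply: mumono; clear -kappa2 alpha1; lra.
  + have -> : 16 = mu `^ (-1) by rewrite powR_inv1 ?(ltW mu0)// invrK.
    rewrite muD -powRrM muD; congr (_ `^ _).
    by rewrite /kappa; ring.
- have pa : 0 < p - alpha by clear -p1 alpha1; lra.
  rewrite -powRrM; congr (_ `^ _).
  have -> : kappa * (alpha * (p - 1) / (p - alpha)) =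
    alpha * (kappa * (p - 1)) / (p - alpha) by ring.
  have -> : kappa * (p - 1) = p - alpha.
    have -> : kappa * (p - 1) =
        p * q - q - alpha * (p * q - p - q + 1) by rewrite /kappa; ring.
    by rewrite pqM; ring.
  by rewrite mulfK// gt_eqF.
Qed.

End HolderExponent.

(** * Hoelder regularity *)

Theorem theorem6p1 (R : realType) (N : nat) (q p delta etam etap M : R)
    (hN : (0 < N)%N) (hq : 2 < q) (hpq : p^-1 + q^-1 = 1) (hdelta : 1 < delta)
    (hetam : 0 <= etam) (hetap : 0 <= etap) (hM : 0 < M) :
  exists theta : R, p < theta /\
  exists C : R -> R, (forall tau, 0 < tau -> 0 < C tau) /\
  forall (D : nat) (T : R) (H : 'rV[R]_N -> R -> 'rV[R]_N -> R)
    (sigma : 'rV[R]_N * R -> 'M[R]_(N, D)) (u : 'rV[R]_N * R -> R),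
  (0 < D)%N -> 0 < T ->
  {within [set y : 'rV[R]_N * R * 'rV[R]_N | open_strip T y.1],
    continuous (fun y => H y.1.1 y.1.2 y.2)} ->
  (forall x t z, 0 < t < T ->
    delta^-1 * frobenius z `^ q - etam <= H x t z
      <= delta * frobenius z `^ q + etap) ->
  locally_lipschitz (open_strip T) sigma ->
  (forall w, open_strip T w -> frobenius (sigma w) <= delta) ->
  {within closed_strip 0 T, continuous u} ->
  viscosity_solution T (fun w => sigma w *m (sigma w)^T) H u ->
  (forall w, closed_strip 0 T w -> `|u w| <= M) ->
  forall tau : R, 0 < tau ->
  forall x1 t1 x2 t2, tau <= t1 <= T -> tau <= t2 <= T ->
    `|u (x1, t1) - u (x2, t2)| <=
      C tau * (frobenius (x1 - x2) `^ ((theta - p) / (theta - 1))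
               + `|t1 - t2| `^ ((theta - p) / theta)).
Proof.
have [p1 p2 pqM] := conjugate_exponent hq hpq.
have delta0 : 0 < delta by clear -hdelta; lra.
pose g : R := (1 - p / 2) / 8.
have g0 : 0 < g by rewrite /g; clear -p2; lra.
pose lam : R := delta * (5 * (g / 10) `^ (1 - q / 2)).
have g10 : 0 < g / 10 by rewrite divr_gt0.
have lam0 : 0 < lam.
  by rewrite mulr_gt0//; apply: mulr_gt0 => //; exact: powR_gt0.
have gL : 5 * (g / 10) `^ (1 - q / 2) <= delta^-1 * lam.
  by rewrite /lam mulKf// gt_eqF.
have L0 : 0 < delta * lam * 32 `^ q.
  by apply: mulr_gt0; [exact: mulr_gt0|exact: powR_gt0].
pose gm : R := Num.min (1 / 4) (1 / 8 / (delta * lam * 32 `^ q)).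
have gm0 : 0 < gm by rewrite lt_min !divr_gt0.
have gm4 : gm <= 1 / 4 by rewrite ge_min lexx.
have gm1 : gm < 1 by clear -gm4; lra.
have gmL : delta * lam * 32 `^ q * gm <= 1 / 8.
  by rewrite mulrC -ler_pdivlMr// ge_min lexx orbT.
have [alpha [gamma [nu [[/andP[alpha0 alpha1] gamma0 gmgamma]]]]] :=
  exists_holder_exponent p1 p2 hq pqM gm0 gm1.
move=> [[nu0 nu256 nugamma scale] [muE nuE]].
(* This theta solves (theta - p) / (theta - 1) = alpha. *)
pose theta := (p - alpha) / (1 - alpha).
have a1 : 0 < 1 - alpha by rewrite subr_gt0.
have pa : 0 < p - alpha by clear -p1 alpha1; lra.
have theta_p : p < theta.
  rewrite ltr_pdivlMr//.
  have : alpha < p * alpha by rewrite ltr_pMl.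
  by clear; lra.
have expx : (theta - p) / (theta - 1) = alpha.
  by rewrite /theta; field; rewrite !gt_eqF//; clear -p1; lra.
have expt : (theta - p) / theta = alpha * (p - 1) / (p - alpha).
  by rewrite /theta; field; rewrite !gt_eqF.
exists theta; split=> //; rewrite expx expt.
set beta := alpha * (p - 1) / (p - alpha) in nuE *.
have beta0 : 0 < beta by rewrite divr_gt0// mulr_gt0// subr_gt0.
pose K := delta ^+ 2.
have K0 : 0 < K by rewrite exprn_gt0.
have etas : 0 < etam + etap + 1 by clear -hetam hetap; lra.
suff /choice[C HC] : forall tau : R, exists c : R, 0 < tau -> 0 < c /\
  forall (D : nat) (T : R) (H : 'rV[R]_N -> R -> 'rV[R]_N -> R)
    (sigma : 'rV[R]_N * R -> 'M[R]_(N, D)) (u : 'rV[R]_N * R -> R),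
  (forall x t z, 0 < t < T ->
    delta^-1 * frobenius z `^ q - etam <= H x t z
      <= delta * frobenius z `^ q + etap) ->
  (forall w, open_strip T w -> frobenius (sigma w) <= delta) ->
  {within closed_strip 0 T, continuous u} ->
  viscosity_solution T (fun w => sigma w *m (sigma w)^T) H u ->
  (forall w, closed_strip 0 T w -> `|u w| <= M) ->
  forall x1 t1 x2 t2, tau <= t1 -> t1 <= t2 -> t2 <= T ->
    `|u (x1, t1) - u (x2, t2)| <=
      c * (frobenius (x1 - x2) `^ alpha + `|t1 - t2| `^ beta).
  exists (fun tau => if 0 < tau then C tau else 1); split.
    by move=> tau tau0; rewrite tau0; have [] := HC _ tau0.
  move=> D T H sigma u _ _ _ Hgrowth _ sigma_le cu visc uM tau tau0.
  move=> x1 t1 x2 t2 /andP[tau1 t1T] /andP[tau2 t2T]; rewrite tau0.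
  have [_ /(_ _ _ _ _ _ Hgrowth sigma_le cu visc uM) holder] := HC _ tau0.
  have [t12|/ltW t21] := leP t1 t2; first exact: holder.
  rewrite distrC [`|t1 - t2|]distrC.
  rewrite (_ : frobenius (x1 - x2) = frobenius (x2 - x1)); last first.
    by rewrite !frobeniusE -sqnormN opprB.
  exact: holder.
move=> tau; have [tau0|] := ltP 0 tau; last by exists 0.
(* Relative size of the diffusion and of the constants allowed at the initial
   scale. *)
pose kap := Num.min (g / 80) (Num.min (1 / 2048) (gm / 16)).
have kap0 : 0 < kap.
  rewrite !lt_min; apply/and3P; split; [exact: divr_gt0| |exact: divr_gt0].
  by rewrite div1r invr_gt0 ltr0n.
have kapg : kap <= g / 80 by rewrite ge_min lexx.
have kap2048 : kap <= 1 / 2048 by rewrite !ge_min lexx orbT.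
have kapgm : kap <= gm / 16 by rewrite !ge_min lexx !orbT.
pose c := Num.min tau (Num.min (kap / K) (kap * M / (etam + etap + 1))).
have c0 : 0 < c.
  rewrite !lt_min tau0 /=; apply/andP; split; first exact: divr_gt0.
  by apply: divr_gt0 => //; exact: mulr_gt0.
have [r [h [r0 h0 hlam hr hc]]] := exists_initial_scale hq lam0 hM c0.
have htau : h <= tau by rewrite (le_trans hc)// ge_min lexx.
have r20 : 0 < r ^+ 2 by rewrite exprn_gt0.
have hK : K * h <= kap * r ^+ 2.
  rewrite mulrC -ler_pdivlMr//; apply: (le_trans hr).
  by rewrite mulrAC ler_pM2r// !ge_min lexx orbT.
have hMeta : (etam + etap + 1) * h <= kap * M.
  rewrite mulrC -ler_pdivlMr//; apply: (le_trans hc).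
  by rewrite !ge_min lexx !orbT.
have eta_le (eta k : R) : eta <= etam + etap + 1 -> kap <= k ->
    eta * h <= k * M.
  move=> etale kk; apply: (@le_trans _ _ ((etam + etap + 1) * h)).
    by rewrite ler_pM2r.
  by apply: (le_trans hMeta); rewrite ler_pM2r.
exists (2 * M / gamma * (r `^ (- alpha) + h `^ (- beta))) => _; split.
  by rewrite mulr_gt0 ?addr_gt0 ?powR_gt0// divr_gt0// mulr_gt0.
move=> D T H sigma u Hgrowth sigma_le cu [subu superu] uM.
move=> x1 t1 x2 t2 tau1 t12 t2T.
have subp := subsolution_paraboloid (ltW delta0) Hgrowth sigma_le subu.
have superp := supersolution_paraboloid (ltW delta0) Hgrowth sigma_le superu.
have [/andP[/eqP x12 /eqP t12E]|] :=
  boolP ((frobenius (x1 - x2) == 0) && (`|t1 - t2| == 0)).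
  have -> : x1 = x2 by apply/eqP; rewrite -subr_eq0; apply/eqP/frobenius_eq0.
  have -> : t1 = t2 by apply/eqP; rewrite -subr_eq0; apply/eqP/normr0_eq0.
  rewrite subrr normr0 mulr_ge0 ?addr_ge0 ?powR_ge0//.
  by rewrite mulr_ge0 ?addr_ge0 ?powR_ge0// divr_ge0 ?mulr_ge0 ?ltW.
rewrite negb_and => neq12.
have ineq01 (b : R) : 0 < b -> b <= 1 / 256 -> 0 < b < 1.
  by move=> b0 b1; rewrite b0; clear -b1; lra.
apply: (@geometric_decay_modulus _ 16^-1 nu gamma alpha beta r h (2 * M)) => //.
- by rewrite invr_gt0 ltr0n invf_lt1 ?ltr1n.
- exact: ineq01.
- by rewrite mulr_gt0.
- exact: frobenius_ge0.
- case/orP: neq12 => [x0|t0]; [left|right]; rewrite lt_neqAle eq_sym.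
    by rewrite x0 frobenius_ge0.
  by rewrite t0 normr_ge0.
- have strip (x : 'rV[R]_N) t : t1 <= t -> t <= t2 -> closed_strip 0 T (x, t).
    move=> t1t tt2; rewrite /closed_strip/= (le_trans tt2 t2T) andbT.
    by rewrite (le_trans _ t1t)// (le_trans _ tau1)// ltW.
  apply: (le_trans (ler_normB _ _)); rewrite mulr2n mulrDl mul1r.
  by apply: lerD; apply: uM; exact: strip.
move=> n dn sn.
have ht2 : h <= t2 by rewrite (le_trans htau)// (le_trans tau1).
have base x t : t2 - h <= t <= t2 -> sqnorm (x - x2) <= r ^+ 2 ->
    `|u (x, t) - 0| <= M.
  move=> /andP[t2ht tt2] _; rewrite subr0; apply: uM.
  rewrite /closed_strip/= (le_trans tt2 t2T) andbT.
  by rewrite (le_trans _ t2ht)// subr_ge0.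
have hKg : K * h <= g / 80 * r ^+ 2.
  by apply: (le_trans hK); rewrite ler_pM2r.
have hK2048 : K * h <= r ^+ 2 / 2048.
  by apply: (le_trans hK); rewrite [leRHS]mulrC ler_pM2r// -div1r.
have etam_le : etam * h <= g / 16 * M.
  by apply: eta_le; [clear -hetap|clear -kapg g0]; lra.
have etap_le : etap * h <= gm / 16 * M.
  by apply: eta_le => //; clear -hetam; lra.
have [m um] := oscillation_iterate subp superp cu delta0 (ltW K0) hetam hetap
  p1 p2 hq pqM g0 (lexx g) gL gm0 gm4 gmL gamma0 gmgamma nu0 nu256 nugamma scale
  t2T n hM r0 h0 hlam hKg hK2048 etam_le etap_le ht2 base.
have rn0 : 0 <= r * 16^-1 ^+ n by rewrite mulr_ge0 ?exprn_ge0 ?invr_ge0// ltW.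
have hn0 : 0 <= h * nu ^+ n by rewrite mulr_ge0 ?exprn_ge0// ltW.
have u1 : `|u (x1, t1) - m| <= M * gamma ^+ n.
  apply: um.
    by move: sn; rewrite distrC ger0_norm ?subr_ge0// t12 andbT; clear; lra.
  by rewrite -sqr_frobenius ler_pXn2r ?nnegrE ?frobenius_ge0//.
have u2 : `|u (x2, t2) - m| <= M * gamma ^+ n.
  apply: um; first by rewrite lexx andbT; clear -hn0; lra.
  by rewrite subrr sqnorm0 sqr_ge0.
have -> : u (x1, t1) - u (x2, t2) = u (x1, t1) - m - (u (x2, t2) - m) by ring.
apply: (le_trans (ler_normB _ _)).
by clear -u1 u2; lra.
Qed.
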